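(* Let $G$ be a chordal graph with vertex set $[m]=\{1,\dots,m\}$. Then the defining polynomial $H_G$ of $\partial\mathcal{C}_G$ is, up to a nonzero constant factor, equal to $$H_G=\prod_{C\ \text{maximal clique of }G}\det(T_{CC}).$$
   Context: Let $G=([m],E)$ be an undirected graph whose edge set $E$ is, by convention, taken to contain all self-loops $(i,i)$. A graph is chordal if every induced cycle of length at least $4$ has a chord (that is, it has no chordless cycle of length $\ge 4$ as an induced subgraph). $\mathbb{R}^E$ is the space of partial symmetric $m\times m$-matrices $T=(t_{ij})$ with entries specified exactly in the positions $(i,j)\in E$ (with $t_{ij}=t_{ji}$). The cone $\mathcal{C}_G\subset\mathbb{R}^E$ is the set of partial matrices that can be extended to a full positive definite symmetric $m\times m$-matrix; it is an open convex cone, and $\partial\mathcal{C}_G=\overline{\mathcal{C}_G}\setminus\mathcal{C}_G$. The polynomial $H_G$ in the entries $t_{ij}$, $(i,j)\in E$, is the squarefree polynomial (unique up to scaling) defining the hypersurface that is the Zariski closure of $\partial\mathcal{C}_G$. For a clique $C$ of $G$, $T_{CC}$ is the (fully specified) principal submatrix of $T$ with rows and columns indexed by $C$. *)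

(* Defs.v *)
From HB Require Import structures.
From mathcomp Require Import all_boot all_order all_algebra.
From mathcomp Require Import complex mpoly.
From mathcomp Require Import boolp classical_sets reals topology normedtype.

Set Implicit Arguments.
Unset Strict Implicit.
Unset Printing Implicit Defensive.

Import Order.TTheory GRing.Theory Num.Theory.
Import numFieldNormedType.Exports.

Local Open Scope classical_set_scope.
Local Open Scope ring_scope.

Section Graph.
Variables (m : nat) (e : rel 'I_m).

(* A cycle is a duplicate-free cyclic sequence of consecutively adjacent
   vertices; a chord joins two of its vertices that are not consecutive. *)
Definition has_chord (c : seq 'I_m) : Prop :=
  exists x y : 'I_m, [/\ x \in c, y \in c, x != y, e x y &
    (y != next c x) && (x != next c y)].

Definition chordal : Prop :=
  forall c : seq 'I_m, (4 <= size c)%N -> ucycle e c -> has_chord c.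

Definition clique (C : {set 'I_m}) : bool :=
  [forall i in C, forall j in C, e i j].

Definition maximal_clique (C : {set 'I_m}) : bool := maxset clique C.

(* Undirected edges, loops included: each is listed once, as (i, j) with
   i <= j. *)
Definition edge : Type := {p : 'I_m * 'I_m | e p.1 p.2 && (p.1 <= p.2)%N}.
HB.instance Definition _ := Finite.on edge.

Definition nb_edges : nat := #|{: edge}|.

Definition edge_index (i j : 'I_m) : option 'I_nb_edges :=
  omap (@enum_rank edge) (insub (if (i <= j)%N then (i, j) else (j, i))).

(* The space K^E is 'rV[K]_nb_edges.  [partial_mx t] is the symmetric matrix
   with entries t_ij at the positions of E; its other entries stand for
   unspecified ones and are set to the dummy value 0. *)
Definition partial_mx (K : nmodType) (t : 'rV[K]_nb_edges) : 'M[K]_m :=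
  \matrix_(i, j) oapp (t 0) 0 (edge_index i j).

End Graph.

Definition principal_submx (K : Type) (m : nat) (C : {set 'I_m})
    (A : 'M[K]_m) : 'M[K]_#|C| :=
  mxsub enum_val enum_val A.

Definition posdefmx (R : numDomainType) (m : nat) (A : 'M[R]_m) : Prop :=
  A^T = A /\ forall x : 'rV[R]_m, x != 0 -> 0 < (x *m A *m x^T) 0 0.

Definition completable_cone (R : realType) (m : nat) (e : rel 'I_m) :
    set 'rV[R]_(nb_edges e) :=
  [set t : 'rV[R]_(nb_edges e) | exists A : 'M[R]_m, posdefmx A /\
     forall i j : 'I_m, e i j -> A i j = partial_mx t i j].

Definition cone_boundary (R : realType) (m : nat) (e : rel 'I_m) :
    set 'rV[R]_(nb_edges e) :=
  closure (@completable_cone R m e) `\` @completable_cone R m e.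

Section AlgebraicGeometry.
Variables (K : fieldType) (n : nat).

Definition zero_locus (p : {mpoly K[n]}) : set 'rV[K]_n :=
  [set z : 'rV[K]_n | p.@[z 0] = 0].

Definition zariski_closure (S : set 'rV[K]_n) : set 'rV[K]_n :=
  [set z : 'rV[K]_n | forall p : {mpoly K[n]}, S `<=` zero_locus p -> zero_locus p z].

Definition squarefree (p : {mpoly K[n]}) : Prop :=
  forall q r : {mpoly K[n]}, p = r * q ^+ 2 -> q \is a GRing.unit.

End AlgebraicGeometry.

(* Zero loci and the Zariski closure are taken in complex affine space: over
   the reals a squarefree polynomial is not determined up to scaling by its
   zero locus (it may have factors without real zeros). *)
Definition boundary_polynomial (R : realType) (m : nat) (e : rel 'I_m)
    (H : {mpoly R[i][nb_edges e]}) : Prop :=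
  squarefree H /\
  zero_locus H =
    zariski_closure (map_mx (real_complex R) @` @cone_boundary R m e).

Definition generic_partial_mx (K : fieldType) (m : nat) (e : rel 'I_m) :
    'M[{mpoly K[nb_edges e]}]_m :=
  partial_mx (\row_k 'X_k).

(* Main.v *)
(** By the theorem of Grone, Johnson, Sa and Wolkowicz, a partial matrix over a
    chordal graph has a positive definite completion iff its clique submatrices
    are positive definite; hence on the boundary some det(T_CC) vanishes.
    Conversely, for a maximal clique C with a vertex i0, the hypersurface
    det(T_CC) = 0 is the image of a polynomial map (N, X), with
    T_CC = N X' N^T where X' is X_CC with row and column i0 cleared. All real
    parameters near a suitable base point land on the boundary, so a polynomial
    vanishing on the boundary vanishes on the whole complex hypersurface. The
    same map shows that the polynomials vanishing on the hypersurface form a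
    prime ideal, and this ideal is generated by det(T_CC), because along the
    lines T + s I this determinant is a characteristic polynomial, separable
    for generic T. So the det(T_CC) are prime elements, pairwise
    non-associated, and a weak Nullstellensatz for hypersurfaces identifies H
    with their product. *)

Require Import Defs.
From HB Require Import structures.
From mathcomp Require Import all_boot all_order all_algebra.
From mathcomp Require Import complex mpoly reals.
From mathcomp Require Import ring lra.
From mathcomp Require Import perm separable boolp classical_sets topology normedtype.

Set Implicit Arguments.
Unset Strict Implicit.
Unset Printing Implicit Defensive.

Import Order.TTheory GRing.Theory Num.Theory.
Import numFieldNormedType.Exports.

Local Open Scope ring_scope.

(** * Polynomials along lines *)

Lemma rmorph_mmap n (A B C : comRingType) (f : {rmorphism B -> C})
    (g : {rmorphism A -> B}) (h : 'I_n -> B) (p : {mpoly A[n]}) :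
  f (mmap g h p) = mmap (f \o g) (f \o h) p.
Proof.
rewrite /mmap rmorph_sum /=; apply: eq_bigr => m _.
rewrite rmorphM /mmap1 rmorph_prod; congr (_ * _).
by apply: eq_bigr => i _; rewrite rmorphXn.
Qed.

(** The sample points 1/(i+1) are real and tend to 0. This suits the density argument, where only
    parameters close to a base point are known to land on the boundary. *)
Lemma poly_nat_eq0 (K : numFieldType) (f : {poly K}) k :
  (forall i, (k <= i)%N -> f.[i.+1%:R^-1] = 0) -> f = 0.
Proof.
move=> f0; apply/eqP/negPn/negP => fn0.
pose s := [seq i.+1%:R^-1 : K | i <- iota k (size f)].
have := max_poly_roots (rs := s) fn0; rewrite size_map size_iota ltnn.
move=> H; apply: notF; apply: H.
  apply/allP => y /mapP; case=> i; rewrite mem_iota => /andP[ki _] ->.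
  by rewrite rootE f0.
rewrite map_inj_uniq ?iota_uniq // => i j /invr_inj/eqP.
by rewrite eqr_nat eqSS => /eqP.
Qed.

Lemma poly_fun_eq0 (K : numFieldType) (f : {poly K}) :
  (forall x, f.[x] = 0) -> f = 0.
Proof. by move=> f0; apply: (@poly_nat_eq0 _ _ 0) => i _. Qed.

Lemma mpoly_fun_eq0 (K : numFieldType) n (p : {mpoly K[n]}) :
  (forall v, p.@[v] = 0) -> p = 0.
Proof.
elim: n p => [|n IHn] p p0.
  have sz: (msize p <= 1)%N.
    rewrite msizeE; apply/bigmax_leqP_seq => m _ _.
    by rewrite mdegE big_ord0.
  by move: (p0 (fun=> 0)); rewrite (msize1_polyC sz) mevalC => ->.
have mp0 : muni p = 0.
  apply/polyP => k; rewrite coef0; apply: IHn => v.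
  have /polyP/(_ k) : map_poly (meval v) (muni p) = 0.
    apply: poly_fun_eq0 => x.
    pose w (i : 'I_n.+1) := if unlift ord_max i is Some j then v j else x.
    rewrite -(p0 w) muniE mevalE rmorph_sum horner_sum; apply: eq_bigr => m _.
    rewrite /= map_polyZ map_polyXn /= mevalZ mevalX hornerZ hornerXn -mulrA.
    rewrite big_ord_recr /= {2}/w unlift_none; congr (_ * (_ * _)).
    apply: eq_bigr => i _; rewrite mnmE /w.
    have -> : widen_ord (leqnSn n) i = lift ord_max i.
      by apply: val_inj; rewrite /= /bump leqNgt ltn_ord.
    by rewrite liftK.
  by rewrite coef_map coef0.
apply/eqP/negPn/negP => pn0.
(* To pass from [muni p = 0] to a contradiction, read off the coefficient of [muni p] at the
   exponents of the leading monomial [m0]: no other monomial contributes to it. *)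
set m0 := mlead p; have m0p : m0 \in msupp p by rewrite mlead_supp.
have /polyP/(_ (m0 ord_max))/mpolyP := mp0.
move=> /(_ [multinom m0 (widen_ord (leqnSn n) i) | i < n]).
rewrite muniE coef_sum raddf_sum coef0 mcoeff0 (bigD1_seq m0) //= big1.
  rewrite coefZ coefXn eqxx mulr1 mcoeffZ mcoeffX eqxx mulr1 addr0 => /eqP.
  by rewrite mleadc_eq0 (negPf pn0).
move=> m mm0; rewrite coefZ coefXn; case: (m0 ord_max =P m ord_max) => [e1|_]; last first.
  by rewrite mulr0 mcoeff0.
rewrite mulr1 mcoeffZ mcoeffX; case: eqP => [/mnmP e2|]; last by rewrite mulr0.
case/eqP: mm0; apply/mnmP => i.
case: (unliftP ord_max i) => [j|] ->; last by rewrite e1.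
have -> : lift ord_max j = widen_ord (leqnSn n) j.
  by apply: val_inj; rewrite /= /bump leqNgt ltn_ord.
by have := e2 j; rewrite !mnmE.
Qed.

Definition mdvd (R : comRingType) n (p q : {mpoly R[n]}) := exists h, q = h * p.

Section Translate.
Variables (K : numFieldType) (n : nat).
Implicit Types (p q : {mpoly K[n]}) (w : 'I_n -> K).

(* p(x + s w), as a polynomial in s over K[x]. *)
Definition translate w p : {poly {mpoly K[n]}} :=
  mmap (polyC \o @mpolyC n K) (fun i => ('X_i)%:P + (w i)%:MP *: 'X) p.

HB.instance Definition _ w := GRing.RMorphism.copy (translate w)
  (mmap (polyC \o @mpolyC n K) (fun i => ('X_i)%:P + (w i)%:MP *: 'X)).

Lemma translateX w i : translate w 'X_i = ('X_i)%:P + (w i)%:MP *: 'X.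
Proof. by rewrite /translate mmapX mmap1U. Qed.

Lemma translate_at0 w p : (translate w p).[0] = p.
Proof.
rewrite -[LHS]/(horner_eval 0 (translate w p)) /translate rmorph_mmap.
rewrite [RHS]mpolyE /mmap; apply: eq_bigr => m _.
rewrite /= /horner_eval hornerC mul_mpolyC; congr (_ *: _).
rewrite /mmap1 mpolyXE_id; apply: eq_bigr => i _; congr (_ ^+ _).
by rewrite /= /horner_eval !hornerE.
Qed.

Lemma translate_meval w a p x :
  (map_poly (meval a) (translate w p)).[x] = p.@[fun i => a i + x * w i].
Proof.
rewrite -[LHS]/(((horner_eval x) \o (map_poly (meval a))) (translate w p)).
rewrite /translate rmorph_mmap mevalE /mmap; apply: eq_bigr => m _.
rewrite /= map_polyC /= mevalC /horner_eval hornerC; congr (_ * _).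
rewrite /mmap1; apply: eq_bigr => i _; congr (_ ^+ _).
by rewrite /= rmorphD /= map_polyC map_polyZ map_polyX /= mevalXU mevalC !hornerE mulrC.
Qed.

End Translate.

(** Wherever [del] does not vanish, the remainder of [Q] by the monic [G] specializes to a multiple
    of the specialized [G] of smaller degree, hence to zero. So [del] times each coefficient of the
    remainder is zero as a function. *)
Lemma monic_dvd_spec (K : numFieldType) n (G Q : {poly {mpoly K[n]}})
    (del : {mpoly K[n]}) :
  G \is monic -> del != 0 ->
  (forall a, del.@[a] != 0 ->
     map_poly (meval a) G %| map_poly (meval a) Q) ->
  exists h, Q = h * G.
Proof.
move=> Gm del0 dvd.
have eqQ := Pdiv.RingMonic.rdivp_eq Gm Q.
set q := Pdiv.Ring.rdivp Q G in eqQ; set r := Pdiv.Ring.rmodp Q G in eqQ.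
have ltr : (size r < size G)%N by rewrite Pdiv.Ring.ltn_rmodp monic_neq0.
suff r0 : r = 0 by exists q; rewrite eqQ r0 addr0.
apply/polyP => k; rewrite coef0; apply/eqP.
suff : del * r`_k = 0 by move/eqP; rewrite mulf_eq0 (negPf del0).
apply: mpoly_fun_eq0 => a; rewrite mevalM.
have [->|da] := eqVneq (del.@[a]) 0; first by rewrite mul0r.
suff ra : map_poly (meval a) r = 0.
  by move/polyP/(_ k): ra; rewrite coef_map coef0 /= => ->; rewrite mulr0.
apply/eqP/negPn/negP => ra.
have dr : map_poly (meval a) G %| map_poly (meval a) r.
  have -> : r = Q - q * G by rewrite {1}eqQ addrC addKr.
  by rewrite rmorphB rmorphM /= dvdp_sub ?dvd // dvdp_mull.
have := dvdp_leq ra dr; rewrite leqNgt => /negP; apply.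
rewrite (@size_map_poly_id0 _ _ _ G).
  apply: leq_ltn_trans ltr; exact: size_poly.
by rewrite (monicP Gm) /= meval1 oner_eq0.
Qed.

(** With nonvanishing leading coefficients the degrees survive specialization, so the Sylvester
    matrix keeps its shape. *)
Lemma meval_resultant (K : numFieldType) n a (p q : {poly {mpoly K[n]}}) :
  (lead_coef p).@[a] != 0 -> (lead_coef q).@[a] != 0 ->
  (resultant p q).@[a] =
    resultant (map_poly (meval a) p) (map_poly (meval a) q).
Proof.
move=> pa qa; rewrite /resultant -det_map_mx /Sylvester_mx.
rewrite !size_map_poly_id0 // map_col_mx; congr (\det (col_mx _ _)).
  by apply: map_lin1_mx => v; rewrite map_poly_rV rmorphM /= map_rVpoly.
by apply: map_lin1_mx => v; rewrite map_poly_rV rmorphM /= map_rVpoly.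
Qed.

Lemma separable_dvdp (K : closedFieldType) (p q : {poly K}) :
  separable_poly p -> (forall x, root p x -> root q x) -> p %| q.
Proof.
move=> sp pq; have [rs ep] := closed_field_poly_normal p.
have p0 := separable_poly_neq0 sp.
have lp : lead_coef p != 0 by rewrite lead_coef_eq0.
rewrite ep dvdpZl //; apply: uniq_roots_dvdp.
  apply/allP => x xrs; apply: pq.
  by rewrite ep rootE hornerZ (rootP _) ?mulr0 ?root_prod_XsubC.
by rewrite uniq_rootsE -separable_prod_XsubC; move: sp; rewrite ep (eqp_separable (eqp_scale _ lp)).
Qed.

(** The resultant [del] of [G] and its derivative does not vanish at [a0], so it is nonzero. Where
    it does not vanish, the specialized [G] has simple roots, all shared with the translate of [q],
    and therefore divides it. [monic_dvd_spec] lifts this to a divisibility, and s = 0 gives the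
    claim. *)
Lemma mdvd_radical (K : numClosedFieldType) n (w a0 : 'I_n -> K)
    (D q : {mpoly K[n]}) :
  translate w D \is monic ->
  separable_poly (map_poly (meval a0) (translate w D)) ->
  (forall v, D.@[v] = 0 -> q.@[v] = 0) -> mdvd D q.
Proof.
set G := translate w D => Gm sep van.
have lead1 a : (lead_coef G).@[a] != 0 by rewrite (monicP Gm) /= meval1 oner_eq0.
have [sG|G1] := leqP (size G) 1.
  exists q; suff -> : D = 1 by rewrite mulr1.
  have e1 : G = 1.
    have {sG} := size1_polyC sG => eG.
    by move: (monicP Gm); rewrite eG lead_coefC => ->.
  by rewrite -(translate_at0 w D) -/G e1 hornerE.
(* As [G] is monic, the leading coefficient of its derivative is the integer deg [G], nonzero in
   characteristic zero. *)
have ld a : (lead_coef G^`()).@[a] != 0.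
  have [d sd] : exists d, size G = d.+2 by case: (size G) G1 => [|[|d]] // _; exists d.
  have cd : G^`()`_d = d.+1%:R.
    by rewrite coef_deriv; move: (monicP Gm); rewrite lead_coefE sd => ->.
  have cda : (G^`()`_d).@[a] != 0 by rewrite cd rmorph_nat pnatr_eq0.
  have -> : lead_coef G^`() = G^`()`_d.
    rewrite lead_coefE; congr (_`__); suff -> : size G^`() = d.+1 by [].
    apply/eqP; rewrite eqn_leq; apply/andP; split.
      by rewrite -ltnS -sd lt_size_deriv ?monic_neq0.
    apply: contraNltn cda => sd'; by rewrite nth_default // meval0.
  by [].
pose del := resultant G G^`().
have delE a : (del.@[a] != 0) = separable_poly (map_poly (meval a) G).
  rewrite meval_resultant // -deriv_map resultant_eq0 -leqNgt.
  rewrite separable_poly.unlock /coprimep leq_eqVlt ltnS leqn0 size_poly_eq0 gcdp_eq0.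
  by rewrite -size_poly_eq0 size_map_poly_id0 // -[size G == _]leqn0 leqNgt (ltnW G1) orbF.
have [|a da|h eh] := @monic_dvd_spec _ _ G (translate w q) del Gm.
- by apply/eqP => d0; move: (delE a0); rewrite sep d0 meval0 eqxx.
- apply: separable_dvdp; first by rewrite -delE.
  move=> x /rootP Dx; apply/rootP; have e := translate_meval w a D x.
  by rewrite (translate_meval w a q x); apply: van; rewrite -e; exact: Dx.
by exists h.[0]; rewrite -(translate_at0 w q) eh hornerM translate_at0.
Qed.

(** * A weak Nullstellensatz for hypersurfaces *)

Section Nullstellensatz.
Variables (K : numClosedFieldType) (n : nat).
Implicit Types (w : 'I_n -> K) (g P : {mpoly K[n]}).

(** The degree is only bounded by [k] and [c] may be zero, so that the property is multiplicative
    without case distinctions. *)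
Let top (k : nat) (c : K) (p : {poly {mpoly K[n]}}) :=
  (size p <= k.+1)%N /\ p`_k = c%:MP.

Let topM k l c d p q : top k c p -> top l d q -> top (k + l) (c * d) (p * q).
Proof.
move=> [sp cp] [sq cq]; split.
  apply: leq_trans (size_polyMleq _ _) _.
  by have := leq_add sp sq; rewrite addSn addnS; case: (_ + _)%N.
have kl : (k < (k + l).+1)%N by rewrite ltnS leq_addr.
rewrite coefM (bigD1 (Ordinal kl)) //= big1 ?addr0.
  by rewrite addKn cp cq mpolyCM.
move=> i ik; have [ki|ki] := ltnP k i.
  by rewrite nth_default ?mul0r // (leq_trans sp).
rewrite [q`_ _]nth_default ?mulr0 // (leq_trans sq) // ltn_subRL ltn_add2r.
by rewrite ltn_neqAle ki andbT.
Qed.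

Let topX k c p e : top k c p -> top (e * k) (c ^+ e) (p ^+ e).
Proof.
move=> tp; elim: e => [|e IHe]; first by split; rewrite ?expr0 ?size_poly1 ?coef1 ?mpolyC1.
by rewrite !exprS mulSn; apply: topM.
Qed.

Let top_translateXm w m : top (mdeg m) ('X_[m].@[w]) (translate w 'X_[m]).
Proof.
rewrite mevalX /translate mmapX /mmap1 mdegE.
apply: (big_rec3 (fun k c p => top k c p)).
  by split; rewrite ?size_poly1 ?coef1 ?mpolyC1.
move=> i k c p _; rewrite -[X in (X + _)%N]muln1; apply: topM; apply: topX.
split; last by rewrite coefD coefC coefZ coefX add0r mulr1.
rewrite (leq_trans (size_polyD _ _)) // geq_max (leq_trans (size_polyC_leq1 _)) //.
by rewrite (leq_trans (size_scale_leq _ _)) // size_polyX.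
Qed.

Let top_translate w g d : (msize g <= d.+1)%N ->
  top d ((pihomog mdeg d g).@[w]) (translate w g).
Proof.
move=> sg.
have eg : translate w g = \sum_(m <- msupp g) (g@_m)%:MP *: translate w 'X_[m].
  rewrite {1}[g]mpolyE rmorph_sum; apply: eq_bigr => m _.
  by rewrite -mul_mpolyC rmorphM /= -mul_polyC; congr (_ * _); rewrite /translate mmapC.
rewrite eg; split.
  apply: leq_trans (size_sum _ _ _) _; apply/bigmax_leqP_seq => m mg _.
  apply: leq_trans (size_scale_leq _ _) _.
  apply: leq_trans (proj1 (top_translateXm w m)) _.
  by rewrite (leq_trans _ sg) // msize_mdeg_lt.
rewrite coef_sum pihomogE (raddf_sum (meval w)) (raddf_sum (@mpolyC n K)).
rewrite [RHS]big_mkcond /= big_seq [RHS]big_seq.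
apply: eq_bigr => m mg; rewrite coefZ.
case: (mdeg m =P d) => [<-|md].
  by rewrite (proj2 (top_translateXm w m)) mevalZ mpolyCM.
rewrite nth_default ?mulr0 // (leq_trans (proj1 (top_translateXm w m))) //.
by have := leq_trans (msize_mdeg_lt mg) sg; rewrite ltnS leq_eqVlt (introF eqP md).
Qed.

(* Along a direction w in which the top form of g does not vanish, g(x + s w)
   is monic in s up to a constant, and every specialization of it divides the
   corresponding specialization of a power of P. *)
Lemma hypersurface_nullstellensatz g P :
  (forall v, g.@[v] = 0 -> P.@[v] = 0) -> exists d, mdvd g (P ^+ d).
Proof.
move=> van; have [g0|gn0] := eqVneq g 0.
  exists 1%N, 1; rewrite g0 mulr0 expr1; apply: mpoly_fun_eq0 => v.
  by apply: van; rewrite g0 meval0.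
have [d sg] : exists d, msize g = d.+1.
  by move: gn0; rewrite -msize_poly_eq0; case: (msize g) => // d _; exists d.
(* The degree [d] part of [g] still contains the leading monomial, so it is nonzero and some
   direction avoids its zeros. *)
have [w tw] : exists w, (pihomog mdeg d g).@[w] != 0.
  apply: contrapT => H; have h0 : pihomog mdeg d g = 0.
    apply: mpoly_fun_eq0 => v; apply/eqP/negPn/negP => vn0; by apply: H; exists v.
  have : (mlead g) \in msupp g by rewrite mlead_supp.
  rewrite mcoeff_msupp.
  have -> : g@_(mlead g) = (pihomog mdeg d g)@_(mlead g).
    rewrite pihomogE raddf_sum big_mkcond (bigD1_seq (mlead g)) //=; last by rewrite mlead_supp.
    have /eqP -> : mdeg (mlead g) == d by rewrite -eqSS mlead_deg ?sg.
    rewrite eqxx mcoeffZ mcoeffX eqxx mulr1 big1 ?addr0 // => m mg.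
    by case: ifP => // _; rewrite mcoeffZ mcoeffX (negPf mg) mulr0.
  by rewrite h0 mcoeff0 eqxx.
set c := _.@[w] in tw; have [szG ldG] := top_translate w (eq_leq sg).
rewrite -/c in ldG.
pose G := c^-1%:MP *: translate w g.
have cn0 : c^-1%:MP != 0 :> {mpoly K[n]} by rewrite mpolyC_eq0 invr_eq0.
have sG : size G = d.+1.
  rewrite size_scale //; apply/eqP; rewrite eqn_leq szG ltnNge.
  by apply: contra tw => sz; rewrite -(mpolyC_eq0 n) -ldG nth_default.
have Gm : G \is monic.
  by rewrite monicE lead_coefE sG coefZ ldG -mpolyCM mulVf.
(* The exponent is the degree of [g]: a specialization of [G] is a product of [d] linear factors,
   each dividing the specialization of the translate of [P]. *)
exists d.
have [|a _|h eh] := @monic_dvd_spec _ _ G (translate w P ^+ d) 1 Gm.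
- exact: oner_neq0.
- rewrite rmorphXn /=; set Ga := map_poly _ G; set Pa := map_poly _ _.
  have [rs eG] := closed_field_poly_normal Ga.
  have sGa : size Ga = d.+1.
    by rewrite size_map_poly_id0 ?sG // (monicP Gm) /= meval1 oner_eq0.
  have la : lead_coef Ga != 0 by rewrite lead_coef_eq0 -size_poly_eq0 sGa.
  move: sGa; rewrite eG size_scale // size_prod_XsubC => -[<-].
  rewrite dvdpZl //.
  have: all (root Pa) rs.
    apply/allP => x xrs; apply/rootP; rewrite (translate_meval w a P x); apply: van.
    rewrite -(translate_meval w a g x); apply: (mulfI (x := c^-1)); first by rewrite invr_eq0.
    rewrite mulr0; have /rootP : root Ga x.
      by apply/rootP; rewrite eG hornerZ (rootP _) ?mulr0 ?root_prod_XsubC.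
    by rewrite /Ga map_polyZ hornerZ /= mevalC.
  elim: rs {eG} => [|x rs IHrs]; first by rewrite big_nil dvd1p.
  by move=> /= /andP[rx /IHrs]; rewrite big_cons exprS; apply: dvdp_mul; rewrite dvdp_XsubCl.
exists (h.[0] * c^-1%:MP); rewrite -[P](translate_at0 w) -horner_exp eh hornerM.
by rewrite hornerZ translate_at0 mulrA.
Qed.
End Nullstellensatz.

(** * Simplicial vertices of chordal graphs *)

Lemma next_catr (T : eqType) (s1 s2 : seq T) a b :
  a \notin s1 -> next (s1 ++ a :: b :: s2) a = b.
Proof.
move=> as1; rewrite next_nth mem_cat inE eqxx orbT /=.
case: s1 as1 => [|c s1] as1 /=; first by rewrite eqxx.
move: as1; rewrite inE negb_or => /andP[ac as1].
rewrite eq_sym (negPf ac) index_cat (negPf as1) /= eqxx addn0.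
by rewrite -cat_rcons nth_cat size_rcons ltnn subnn.
Qed.

Lemma next_last (T : eqType) (s : seq T) a :
  uniq (a :: s) -> next (a :: s) (last a s) = a.
Proof.
by move=> us; rewrite next_nth mem_last index_last // nth_default.
Qed.

Section Dirac.
Variables (m : nat) (e : rel 'I_m).
Hypotheses (e_refl : reflexive e) (e_sym : ssrbool.symmetric e).
Hypothesis e_chordal : chordal e.
Implicit Types (S Q : {set 'I_m}) (x y v : 'I_m) (p q : seq 'I_m).

(* Otherwise v and a shortest path from x to y through S form a chordless
   cycle of length at least four. *)
Lemma chordal_boundary_adj S v x y q :
  (forall z, z \in S -> ~~ e v z) -> e v x -> e v y ->
  (forall z, z \in q -> (z \in S) || (z == y)) -> path e x q -> last x q = y ->
  e x y.
Proof.
(* Induction on the length of [q] replaces the choice of a shortest path: if [x] and [y] are not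
   adjacent, a shorter path from [x] to [y] inside [q] is contradictory. *)
have [k] := ubnP (size q); elim: k => // k IHk in q *; rewrite ltnS => qk.
move=> vS vx vy qS xq lq; apply/negPn/negP => nxy.
have IH p : (size p < size q)%N -> {subset p <= q} -> path e x p ->
    last x p = y -> False.
  move=> pq sub xp lp; case/negP: nxy; apply: (IHk p) => //.
    exact: leq_trans pq qk.
  by move=> z zp; apply: qS; apply: sub.
have uq : uniq (x :: q).
  apply/negPn/negP => nuq.
  have [p'] : exists p', [/\ path e x p', uniq (x :: p'), {subset p' <= q} & last x p' = y].
    by rewrite -lq; case: (shortenP xq) => p' *; exists p'.
  case=> xp' up' sub lp'; apply: (IH p') => //.
  rewrite ltnNge; apply: contra nuq => sz.
  apply: (leq_size_uniq up') => // z; rewrite !inE => /orP[->//|/sub ->].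
  by rewrite orbT.
have vq : v \notin x :: q.
  rewrite inE negb_or; apply/andP; split.
    by apply: contraNneq nxy => <-.
  apply/negP => /qS /orP[/vS|/eqP vy']; first by rewrite e_refl.
  by case/negP: nxy; rewrite -vy' e_sym.
have uc : uniq (v :: x :: q) by rewrite /= vq.
have yq : y \in q.
  have := mem_last x q; rewrite lq inE => /orP[/eqP yx|//].
  by rewrite yx e_refl in nxy.
have sz : (1 < size q)%N.
  case: q {qk qS IH uq vq uc} xq lq yq => [|a [|b q]] //= ; rewrite andbT => xa ay.
  by rewrite -ay xa in nxy.
have cyc : ucycle e (v :: x :: q).
  by rewrite /ucycle uc /= rcons_path vx xq lq e_sym vy.
(* A chord at [v] must end in [y], which is consecutive to [v] on the cycle. A chord between two
   path vertices shortcuts the path, since at least one vertex [t] lies strictly between them. *)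
have nchord a b : (index a (v :: x :: q) < index b (v :: x :: q))%N ->
    b \in v :: x :: q -> e a b -> b != next (v :: x :: q) a ->
    a != next (v :: x :: q) b -> False.
  move=> ab bc eab nb na.
  have {}bc : b \in x :: q.
    by move: bc ab; rewrite inE => /orP[/eqP ->|//]; rewrite /= eqxx.
  have [av|av] := eqVneq a v.
    move: na nb; rewrite av => na; rewrite /= eqxx => bx.
    move: bc; rewrite inE (negPf bx) /= => bq.
    case/orP: (qS _ bq) na => [/vS|/eqP ->]; first by rewrite -av eab. move=> na.
    move: na; have -> : y = last v (x :: q) by rewrite /= lq.
    by rewrite next_last ?eqxx.
  have {}ab : (index a (x :: q) < index b (x :: q))%N.
    move: ab; rewrite /= eq_sym (negPf av).
    by have [vb|//] := eqVneq v b; rewrite vb bc in vq.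
  have {ab} [s1 [s2 [eq_w bs2]]] : exists s1 s2, x :: q = s1 ++ a :: s2 /\ b \in s2.
    have aw : a \in x :: q by rewrite -index_mem (ltn_trans ab) // index_mem.
    move: bc ab; case/splitPr: aw uq {uc vq cyc nb na} => s1 s2.
    rewrite cat_uniq /= negb_or => /and3P[us1 /andP[as1 _] _].
    rewrite mem_cat => bc; rewrite !index_cat (negPf as1) /= eqxx addn0.
    move: bc; case: ifP => [bs1 _|bs1 /= bs2].
      by rewrite ltnNge index_size.
    case: eqP => [_|/eqP ab _]; first by rewrite addn0 ltnn.
    by exists s1, s2; split=> //; move: bs2; rewrite inE eq_sym (negPf ab).
  case/splitPr: bs2 eq_w => t s3 eq_w.
  have t0 : (0 < size t)%N.
    case: t eq_w => //= eq_w.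
    have eq_c : v :: x :: q = (v :: s1) ++ a :: b :: s3 by rewrite eq_w.
    case/eqP: nb; rewrite eq_c next_catr //.
    by move: uc; rewrite eq_c cat_uniq /= !negb_or => /and3P[_ /andP[]].
  case: s1 eq_w => [|c s1] /= [exa eq_q]; subst.
    apply: (IH (b :: s3)).
    - by rewrite size_cat -[X in (X < _)%N]add0n ltn_add2r.
    - by move=> z zs; rewrite mem_cat zs orbT.
    - by move: xq; rewrite cat_path /= => /and3P[_ _ ->]; rewrite eab.
    - by rewrite last_cat.
  apply: (IH (s1 ++ a :: b :: s3)).
  - by rewrite !size_cat ltn_add2l /= ltnS size_cat -[X in (X < _)%N]add0n ltn_add2r.
  - by move=> z; rewrite !(mem_cat, inE) => /or4P[]->; rewrite ?orbT.
  - move: xq; rewrite !cat_path /= cat_path /= => /and5P[-> -> _ _ ->].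
    by rewrite eab.
  - by rewrite !last_cat /= last_cat.
have [a [b [ac bc ab eab /andP[nb na]]]] := @e_chordal (v :: x :: q) sz cyc.
have [lt_ab|lt_ba|/index_inj] := ltngtP (index a (v :: x :: q)) (index b (v :: x :: q)).
- exact: nchord nb na.
- by apply: nchord na nb => //; rewrite e_sym.
- by move=> /(_ v ac bc) /eqP; rewrite (negPf ab).
Qed.

Lemma cliqueP (C : {set 'I_m}) :
  reflect {in C &, forall x y, e x y} (clique e C).
Proof.
apply: (iffP forall_inP) => [H x y xC yC|H x xC].
  by move/forall_inP: (H x xC); apply.
by apply/forall_inP => y yC; apply: H.
Qed.

Definition simplicial S v :=
  (v \in S) && clique e [set x in S | e v x].

(* If some v in Q is not adjacent to all of S, recurse on a component K of
   S minus the neighbours of v, together with the clique formed by the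
   neighbours of v that bound K; otherwise recurse on S minus Q. *)
Lemma simplicial_outside S Q :
  Q \proper S -> clique e Q -> exists2 v, v \notin Q & simplicial S v.
Proof.
have [k] := ubnP #|S|; elim: k => // k IHk in S Q *; rewrite ltnS => Sk.
(* An empty [Q] is replaced by a singleton, unless [S] is itself a singleton and its vertex is
   trivially simplicial. Both recursions need a vertex of [R] to shrink [S]. *)
suff main R : R != finset.set0 -> R \proper S -> clique e R ->
    exists2 v, v \notin R & simplicial S v.
  move=> QS cQ; have [Q0|] := eqVneq Q finset.set0; last by move/main; apply.
  have [v vS _] : exists2 v, v \in S & v \notin Q by case/properP: QS.
  have [Sv|Sv] := eqVneq S [set v]%SET.
    exists v; first by rewrite Q0 inE.
    rewrite /simplicial vS; apply/cliqueP => x y; rewrite Sv !inE.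
    by move=> /andP[/eqP-> _] /andP[/eqP-> _].
  have [|||w _ sw] := main [set v]%SET.
  - by apply/finset.set0Pn; exists v; rewrite inE.
  - by rewrite finset.properEneq eq_sym Sv finset.sub1set.
  - by apply/cliqueP => x y; rewrite !inE => /eqP-> /eqP->.
  by exists w; rewrite // Q0 inE.
move=> R0 RS cR; have /andP[/fintype.subsetP RsubS _] := RS.
have [/exists_inP[v vR /exists_inP[u uS nvu]]|univ] :=
    boolP [exists v in R, exists u in S, ~~ e v u]; last first.
  have {}univ x y : x \in R -> y \in S -> e x y.
    move=> xR yS; apply: contraR univ => nxy.
    by apply/exists_inP; exists x => //; apply/exists_inP; exists y.
  have [z zS zR] : exists2 z, z \in S & z \notin R by case/properP: RS.
  (* Vertices of [R] are adjacent to all of [S], so a simplicial vertex of [S :\: R] remains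
     simplicial in [S]. *)
  have [|||w _ /andP[]] := IHk (S :\: R) finset.set0.
  - apply: leq_trans Sk; apply: proper_card; rewrite fintype.properE finset.subsetDl /=.
    case/finset.set0Pn: R0 => r rR; apply/subsetPn; exists r; first exact: RsubS.
    by rewrite inE rR.
  - apply/properP; split; first exact: finset.sub0set.
    by exists z; rewrite !inE ?zR.
  - by apply/cliqueP => x y; rewrite inE.
  rewrite inE => /andP[wR wS] /cliqueP cw; exists w => //.
  rewrite /simplicial wS; apply/cliqueP => x y.
  rewrite !inE => /andP[xS wx] /andP[yS wy].
  have [xR|xR] := boolP (x \in R); first exact: univ.
  have [yR|yR] := boolP (y \in R); first by rewrite e_sym univ.
  by apply: cw; rewrite !inE ?xR ?yR ?xS ?yS.
pose S0 : {set 'I_m} := [set z in S | ~~ e v z].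
pose r : rel 'I_m := [rel x y | [&& e x y, x \in S0 & y \in S0]].
have rsym : connect_sym r.
  apply: sym_connect_sym => x y; rewrite /r /= e_sym.
  by rewrite [(x \in S0) && _]andbC.
pose K : {set 'I_m} := [set z | connect r u z].
have uS0 : u \in S0 by rewrite inE uS.
have rS0 x p : x \in S0 -> path r x p -> {subset p <= S0}.
  elim: p x => //= y p IHp x xS0 /andP[/and3P[_ _ yS0] yp] z.
  by rewrite inE => /orP[/eqP->|/(IHp y yS0 yp)].
have KS0 z : z \in K -> z \in S0.
  rewrite inE => /connectP[p up ->]; have := mem_last u p.
  by rewrite inE => /orP[/eqP->|/(rS0 _ _ uS0 up)].
pose Bd : {set 'I_m} := [set x in S | e v x && [exists z in K, e x z]].
have S0P z : z \in S0 -> ~~ e v z by rewrite inE => /andP[].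
have vS := RsubS v vR.
have vS' : v \notin K :|: Bd.
  apply/negP; rewrite inE => /orP[/KS0/S0P|]; first by rewrite e_refl.
  by rewrite inE => /and3P[_ _ /exists_inP[z /KS0/S0P/negP]].
have S'S : K :|: Bd \subset S.
  apply/fintype.subsetP => z; rewrite inE => /orP[/KS0|]; rewrite inE; first by case/andP.
  by case/and3P.
(* Two vertices of [Bd] are neighbours of [v] joined by a path through the connected set [K], which
   avoids the neighbours of [v]. *)
have cBd : clique e Bd.
  apply/cliqueP => x y; rewrite inE => /and3P[xS vx /exists_inP[zx zxK xzx]].
  rewrite inE => /and3P[yS vy /exists_inP[zy zyK yzy]].
  have /connectP[p zp lp] : connect r zx zy.
    apply: (@connect_trans _ _ u); last by move: zyK; rewrite inE.
    by rewrite rsym; move: zxK; rewrite inE.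
  apply: (@chordal_boundary_adj S0 v x y (zx :: rcons p y)) => //.
  - move=> z; rewrite inE mem_rcons inE => /or3P[/eqP->|->|/(rS0 _ _ (KS0 _ zxK) zp)->] //.
      by rewrite KS0.
    by rewrite orbT.
  - rewrite /= xzx rcons_path -lp (e_sym zy) yzy andbT.
    by apply: sub_path zp => a b /and3P[].
  - by rewrite /= last_rcons.
have [|||w wBd /andP[wS' /cliqueP cw]] := IHk (K :|: Bd) Bd.
- apply: leq_trans Sk; apply: proper_card; rewrite fintype.properE S'S /=.
  by apply/subsetPn; exists v.
- apply/properP; split; first exact: finset.subsetUr.
  by exists u; rewrite !inE ?connect0 // (negPf nvu) andbF.
- by [].
have wK : w \in K by move: wS'; rewrite inE (negPf wBd) orbF.
have wS0 := KS0 w wK.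
exists w.
  apply/negP => wR; have /negP := S0P w wS0; apply.
  by move/cliqueP: cR; apply.
(* All neighbours of [w] in [S] already lie in [K :|: Bd], so simpliciality passes from there to
   [S]. *)
have nbr x : x \in S -> e w x -> x \in K :|: Bd.
  move=> xS wx; rewrite inE; have [vx|vx] := boolP (e v x).
    rewrite [x \in Bd]inE xS vx /= [X in _ || X](_ : _ = true) ?orbT //.
    by apply/exists_inP; exists w; rewrite // e_sym.
  rewrite inE; apply/orP; left.
  apply: (@connect_trans _ _ w); first by move: wK; rewrite inE.
  by apply: connect1; rewrite /r /= wx wS0 inE xS vx.
rewrite /simplicial (fintype.subsetP S'S _ wS'); apply/cliqueP => x y.
rewrite !inE => /andP[xS wx] /andP[yS wy].
by apply: cw; rewrite inE ?wx ?wy andbT nbr.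
Qed.

End Dirac.

(** * Positive definite completion *)

Definition bform (R : pzRingType) m (A : 'M[R]_m) (x y : 'rV[R]_m) : R :=
  (x *m A *m y^T) 0 0.

(** Principal submatrices are handled through full-length vectors supported on [S] and the 0/1
    matrices [mask], so that matrices of size [#|S|] are rarely needed. *)
Definition supported (R : pzRingType) m (S : {set 'I_m}) (x : 'rV[R]_m) :=
  forall i, i \notin S -> x 0 i = 0.

Definition posdef_on (R : numDomainType) m (S : {set 'I_m}) (A : 'M[R]_m) :=
  forall x, supported S x -> x != 0 -> 0 < bform A x x.

Definition mask (R : pzRingType) m (S : {set 'I_m}) : 'M[R]_m :=
  diag_mx (\row_j (j \in S)%:R).

Section Forms.
Variables (R : comPzRingType) (m : nat).
Implicit Types (A B : 'M[R]_m) (x y z : 'rV[R]_m).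

Lemma bformE A x y : bform A x y = \sum_i \sum_j x 0 i * A i j * y 0 j.
Proof.
rewrite /bform mxE exchange_big; apply: eq_bigr => j _ /=.
by rewrite !mxE mulr_suml; apply: eq_bigr => i _.
Qed.

Lemma bformBl A x y z : bform A (x - y) z = bform A x z - bform A y z.
Proof. by rewrite /bform !mulmxBl !mxE. Qed.

Lemma bformBr A x y z : bform A x (y - z) = bform A x y - bform A x z.
Proof. by rewrite /bform linearB /= !mulmxBr !mxE. Qed.

Lemma bformDm A B x y : bform (A + B) x y = bform A x y + bform B x y.
Proof. by rewrite /bform mulmxDr mulmxDl !mxE. Qed.

Lemma bform_congr (N : 'M_m) A x y :
  bform (N *m A *m N^T) x y = bform A (x *m N) (y *m N).
Proof. by rewrite /bform trmx_mul !mulmxA. Qed.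

Lemma bform1 x : bform 1%:M x x = \sum_i x 0 i ^+ 2.
Proof. by rewrite /bform mulmx1 mxE; apply: eq_bigr => i _; rewrite mxE. Qed.

Lemma bform_delta A i j : bform A (delta_mx 0 i) (delta_mx 0 j) = A i j.
Proof. by rewrite /bform trmx_delta -rowE -colE !mxE. Qed.

Lemma bformC A x y : A^T = A -> bform A x y = bform A y x.
Proof.
move=> sA; rewrite !bformE exchange_big; apply: eq_bigr => i _.
apply: eq_bigr => j _ /=; rewrite -{1}sA mxE mulrC mulrA.
by rewrite [in LHS]mulrAC.
Qed.

Lemma eq_bform A B x y :
  (forall i j, x 0 i != 0 -> y 0 j != 0 -> A i j = B i j) ->
  bform A x y = bform B x y.
Proof.
move=> AB; rewrite !bformE; apply: eq_bigr => i _; apply: eq_bigr => j _.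
have [->|xi] := eqVneq (x 0 i) 0; first by rewrite !mul0r.
have [->|yj] := eqVneq (y 0 j) 0; first by rewrite !mulr0.
by rewrite AB.
Qed.

Lemma mul_maskE S x j : (x *m mask R S) 0 j = x 0 j * (j \in S)%:R.
Proof. by rewrite /mask mul_mx_diag !mxE. Qed.

Lemma supported_mask (S : {set 'I_m}) x : supported S (x *m mask R S).
Proof. by move=> i iS; rewrite mul_maskE (negPf iS) mulr0. Qed.

Lemma mask_id S x : supported S x -> x *m mask R S = x.
Proof.
move=> sx; apply/rowP => j; rewrite mul_maskE.
by have [_|/sx->] := boolP (j \in S); rewrite ?mulr1 ?mul0r.
Qed.

Lemma tr_mask (S : {set 'I_m}) : (mask R S)^T = mask R S.
Proof. exact: tr_diag_mx. Qed.

Lemma mask_mxE (S T : {set 'I_m}) A i j :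
  (mask R S *m A *m mask R T) i j = (i \in S)%:R * A i j * (j \in T)%:R.
Proof. by rewrite /mask mul_mx_diag mul_diag_mx !mxE. Qed.

End Forms.

Section PosDef.
Variables (R : realFieldType) (m : nat).
Implicit Types (A B : 'M[R]_m) (x y z : 'rV[R]_m).

Lemma sumsq_ge0 x : 0 <= \sum_i x 0 i ^+ 2.
Proof. by apply: sumr_ge0 => i _; rewrite sqr_ge0. Qed.

Lemma sumsq_gt0 x : x != 0 -> 0 < \sum_i x 0 i ^+ 2.
Proof.
move=> x0; rewrite lt_neqAle sumsq_ge0 andbT eq_sym; apply: contra x0.
rewrite psumr_eq0; last by move=> i _; rewrite sqr_ge0.
move=> /allP x0; apply/eqP/rowP => i; rewrite mxE; apply/eqP.
by rewrite -sqrf_eq0 -[_ == 0]implyTb x0 // mem_index_enum.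
Qed.

Lemma posdefmx1 : posdefmx (1%:M : 'M[R]_m).
Proof.
split=> [|x x0]; first exact: trmx1.
by rewrite -[X in 0 < X]/(bform _ _ _) bform1 sumsq_gt0.
Qed.

Lemma posdef_unit A : (forall x, x != 0 -> bform A x x != 0) -> A \in unitmx.
Proof.
move=> pA; rewrite unitmxE unitfE; apply/det0P => -[x x0 xA].
by move/eqP: (pA x x0); rewrite /bform xA mul0mx mxE.
Qed.

(** Completing the block of [A] on [N] by the identity off [N] gives a definite, hence invertible,
    matrix [M] of full size. Off [N] the system for [M] then forces [w] to vanish. *)
Lemma posdef_solve A (N : {set 'I_m}) (b : 'rV_m) :
  posdef_on N A ->
  exists2 w, supported N w & forall j, j \in N -> (w *m A) 0 j = b 0 j.
Proof.
move=> pA; pose M := mask R N *m A *m mask R N + mask R (~: N).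
have ME x : bform M x x =
    bform A (x *m mask R N) (x *m mask R N) + \sum_i (x *m mask R (~: N)) 0 i ^+ 2.
  rewrite /M bformDm -{2}(tr_mask R N) bform_congr; congr (_ + _).
  rewrite -bform1 -bform_congr mulmx1 tr_mask !bformE.
  apply: eq_bigr => i _; apply: eq_bigr => j _.
  rewrite /mask mul_mx_diag !mxE; case: (eqVneq i j) => [->|_]; rewrite ?mulr1n ?mulr0n ?mul0r //.
  by case: (_ \in _); rewrite ?mulr1 ?mulr0.
have uM : M \in unitmx.
  apply: posdef_unit => x x0; rewrite ME; apply: lt0r_neq0.
  have [xN|xN] := eqVneq (x *m mask R N) 0.
    rewrite ltr_wpDl ?xN ?/bform ?mul0mx ?mxE // sumsq_gt0 //.
    apply: contra x0 => /eqP xN'; apply/eqP/rowP => j.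
    have /rowP/(_ j) := xN; have /rowP/(_ j) := xN'; rewrite !mul_maskE !mxE inE.
    by case: (j \in N); rewrite ?mulr1.
  by rewrite ltr_pwDl ?sumsq_ge0 // pA //; apply: supported_mask.
pose w := (b *m mask R N) *m invmx M.
have wM : w *m M = b *m mask R N by rewrite /w mulmxKV.
have wMj j : (w *m M) 0 j = (w *m mask R N *m A) 0 j * (j \in N)%:R + w 0 j * (j \notin N)%:R.
  by rewrite /M mulmxDr !mulmxA mxE !mul_maskE inE.
have sw : supported N w.
  move=> j jN; have := wMj j.
  by rewrite wM mul_maskE (negPf jN) !mulr0 add0r mulr1.
exists w => // j jN; have := wMj j.
by rewrite wM mul_maskE jN mulr1 mulr0 addr0 mulr1 mask_id.
Qed.

(* The form of A' is pulled back along the linear map that sends the basis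
   vector of v to w and fixes the others. *)
Lemma posdef_extend A' (v : 'I_m) (w : 'rV_m) (s : R) :
  posdefmx A' -> w 0 v = 0 -> 0 < s ->
  exists A, [/\ posdefmx A, forall i j, i != v -> j != v -> A i j = A' i j,
    forall j, j != v -> A v j = (w *m A') 0 j &
    A v v = bform A' w w + s].
Proof.
move=> [sA' pA'] wv s0.
pose r i : 'rV[R]_m := if i == v then w else delta_mx 0 i.
pose P := \matrix_i r i.
have PE i j : (P *m A' *m P^T) i j = bform A' (r i) (r j).
  by rewrite -bform_delta bform_congr -!rowE !rowK.
pose A := P *m A' *m P^T + s *: delta_mx v v.
have AE i j : A i j = bform A' (r i) (r j) + s * ((i == v) && (j == v))%:R.
  by rewrite /A mxE PE; congr (_ + _); rewrite !mxE.
exists A; split.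
- split.
    rewrite /A linearD linearZ /= trmx_delta; congr (_ + _).
    by rewrite !trmx_mul trmxK sA' mulmxA.
  move=> x x0; rewrite -[X in 0 < X]/(bform _ _ _) /A bformDm bform_congr.
  have -> : bform (s *: delta_mx v v) x x = s * x 0 v ^+ 2.
    rewrite bformE (bigD1 v) //= (bigD1 v) //= !big1 ?addr0.
    - by rewrite !mxE !eqxx mulr1 mulrAC -expr2 mulrC.
    - by move=> i iv; rewrite big1 // => j _; rewrite !mxE (negPf iv) !mulr0 mul0r.
    - by move=> j jv; rewrite !mxE (negPf jv) andbF !mulr0 mul0r.
  have [xv|xv] := eqVneq (x 0 v) 0; last first.
    apply: ltr_wpDl; last by rewrite mulr_gt0 // exprn_even_gt0 // xv orbT.
    have [->|xP] := eqVneq (x *m P) 0; last exact/ltW/pA'.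
    by rewrite /bform !mul0mx mxE.
  have -> : x *m P = x.
    rewrite mulmx_sum_row [RHS]row_sum_delta; apply: eq_bigr => i _.
    by rewrite rowK /r; case: eqP => // ->; rewrite xv !scale0r.
  by rewrite xv expr0n mulr0 addr0; apply: pA'.
- move=> i j iv jv; rewrite AE /r (negPf iv) (negPf jv) bform_delta.
  by rewrite mulr0 addr0.
- move=> j jv; rewrite AE /r eqxx (negPf jv) mulr0 addr0.
  by rewrite /bform trmx_delta -colE mxE.
by rewrite AE /r eqxx mulr1.
Qed.

(* Grone, Johnson, Sa and Wolkowicz: by induction along an elimination ordering
   of simplicial vertices. *)
Theorem chordal_completion (e : rel 'I_m) (T : 'M[R]_m) :
  reflexive e -> ssrbool.symmetric e -> chordal e -> T^T = T ->
  (forall C, clique e C -> posdef_on C T) ->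
  exists2 A, posdefmx A & forall i j, e i j -> A i j = T i j.
Proof.
move=> e_refl e_sym e_ch sT pT.
have TC i j : T i j = T j i by rewrite -{1}sT mxE.
suff H (S : {set 'I_m}) :
    exists2 A, posdefmx A & {in S &, forall i j, e i j -> A i j = T i j}.
  by have [A pA AT] := H [set: 'I_m]; exists A => // i j; apply: AT; rewrite inE.
have [k] := ubnP #|S|; elim: k => // k IHk in S *; rewrite ltnS => Sk.
have [->|S0] := eqVneq S finset.set0.
  by exists 1%:M => [|i j]; [exact: posdefmx1|rewrite inE].
have [||v _ /andP[vS /cliqueP cv]] :=
  simplicial_outside e_refl e_sym e_ch (S := S) (Q := finset.set0).
- by rewrite finset.proper0.
- by apply/cliqueP => x y; rewrite inE.
have [|A' pA' A'T] := IHk (S :\ v)%SET.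
- by apply: leq_trans Sk; apply: proper_card; apply: properD1.
pose N : {set 'I_m} := [set x in S | e v x & x != v].
have NS (x : 'I_m) : x \in N -> [/\ x \in S, e v x & x != v].
  by rewrite inE => /and3P[].
have eN : {in N &, forall i j, A' i j = T i j}.
  move=> x y /NS[xS vx xv] /NS[yS vy yv]; apply: A'T; rewrite ?inE ?xv ?yv //.
  by apply: cv; rewrite inE ?xS ?yS.
(* The new row of [v] will be [w *m A'], which agrees with the prescribed entries of [T] on the
   neighbours of [v]. *)
have [|w sw wA'] := @posdef_solve A' N (row v T).
  by move=> x _ x0; apply: (proj2 pA').
have wv : w 0 v = 0 by apply: sw; rewrite inE eqxx !andbF.
have wN i : w 0 i != 0 -> i \in N by apply: contraR => /sw ->.
have ww : bform T w w = bform A' w w.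
  by apply: eq_bform => i j /wN iN /wN jN; rewrite eN.
have wTv : bform T w (delta_mx 0 v) = bform A' w w.
  rewrite /bform trmx_delta -colE mxE [LHS]mxE [RHS]mxE; apply: eq_bigr => j _.
  rewrite [w^T _ _]mxE; have [->|/wN jN] := eqVneq (w 0 j) 0.
    by rewrite mul0r mulr0.
  by rewrite wA' // mxE TC mulrC.
(* This Schur complement is the form of [T] at e_v - w, a nonzero vector supported on the clique
   formed by [v] and [N]. *)
have s0 : 0 < T v v - bform A' w w.
  have : 0 < bform T (delta_mx 0 v - w) (delta_mx 0 v - w).
    apply: (pT (v |: N)%SET).
    - apply/cliqueP => x y; rewrite in_setU1 => /predU1P xN; rewrite in_setU1 => /predU1P yN.
      apply: cv; rewrite inE.
        by case: xN => [->|/NS[-> -> _]] //; rewrite vS e_refl.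
      by case: yN => [->|/NS[-> -> _]] //; rewrite vS e_refl.
    - move=> i; rewrite in_setU1 negb_or => /andP[iv iN].
      by rewrite !mxE (negPf iv) andbF sw // subr0.
    apply/eqP => /rowP/(_ v); rewrite !mxE !eqxx wv subr0 /= => /eqP.
    by rewrite oner_eq0.
  rewrite bformBl !bformBr bform_delta [bform T _ w]bformC // wTv ww.
  by rewrite subrr subr0.
have [A [pA AA' Av Avv]] := posdef_extend pA' wv s0.
have AvT j : j \in S -> e v j -> A v j = T v j.
  move=> jS vj; have [->|jv] := eqVneq j v; first by rewrite Avv addrC subrK.
  by rewrite Av // wA' ?mxE // inE jS vj.
exists A => // i j iS jS eij.
have [iv|iv] := eqVneq i v; first by rewrite iv AvT // -iv.
have [jv|jv] := eqVneq j v.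
  by rewrite jv TC -(AvT i) // -?jv 1?e_sym // -{1}(proj1 pA) mxE.
by rewrite AA' // A'T // !inE ?iv ?jv.
Qed.

End PosDef.

(** * Partial matrices and principal minors *)

Section PartialMatrices.
Variables (m : nat) (e : rel 'I_m).
Hypothesis e_sym : ssrbool.symmetric e.

Definition edge_row (K : Type) (A : 'M[K]_m) : 'rV[K]_(nb_edges e) :=
  \row_k A (val (enum_val k)).1 (val (enum_val k)).2.

Lemma edge_indexC i j : edge_index e i j = edge_index e j i.
Proof.
rewrite /edge_index; congr (omap _ (insub _)).
by case: ltngtP => // /ord_inj ->.
Qed.

Lemma partial_mx_sym (K : nmodType) (t : 'rV[K]_(nb_edges e)) :
  (partial_mx t)^T = partial_mx t.
Proof. by apply/matrixP => i j; rewrite !mxE edge_indexC. Qed.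

Lemma partial_edge_row (K : nmodType) (A : 'M[K]_m) i j :
  A^T = A -> e i j -> partial_mx (edge_row A) i j = A i j.
Proof.
move=> sA; wlog ij : i j / (i <= j)%N => [H|eij].
  have [ij|/ltnW ji] := leqP i j; first exact: H.
  rewrite e_sym => eji; rewrite -(partial_mx_sym (edge_row A)) [LHS]mxE H //.
  by rewrite -[in RHS]sA mxE.
rewrite mxE /edge_index ij insubT /= ?eij // => eij'.
by rewrite mxE enum_rankK.
Qed.

Lemma eq_edge_row (K : nmodType) (A : 'M[K]_m) (t : 'rV[K]_(nb_edges e)) :
  (forall i j, e i j -> A i j = partial_mx t i j) -> edge_row A = t.
Proof.
move=> At; apply/rowP => k; rewrite mxE.
case ek : (enum_val k) => [[i j] /= eij]; have [eij' ij] := andP eij.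
rewrite At // mxE /edge_index ij insubT; congr (t 0 _).
by rewrite -[RHS]enum_valK; congr enum_rank; apply: val_inj; rewrite ek.
Qed.

Lemma map_partial_mx (K L : nmodType) (f : K -> L) (t : 'rV[K]_(nb_edges e)) :
  f 0 = 0 -> map_mx f (partial_mx t) = partial_mx (map_mx f t).
Proof.
move=> f0; apply/matrixP => i j; rewrite !mxE.
by case: (edge_index e i j) => [k|] /=; rewrite ?mxE.
Qed.

Lemma map_edge_row (K L : Type) (f : K -> L) (A : 'M[K]_m) :
  map_mx f (edge_row A) = edge_row (map_mx f A).
Proof. by apply/matrixP => i j; rewrite !mxE. Qed.

Lemma map_principal_submx (K L : Type) (f : K -> L) (C : {set 'I_m}) (A : 'M[K]_m) :
  map_mx f (principal_submx C A) = principal_submx C (map_mx f A).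
Proof. by apply/matrixP => i j; rewrite !mxE. Qed.

Definition clique_det (K : fieldType) (C : {set 'I_m}) : {mpoly K[nb_edges e]} :=
  \det (principal_submx C (generic_partial_mx K e)).

Lemma clique_detE (K : fieldType) C (v : 'I_(nb_edges e) -> K) :
  (clique_det K C).@[v] = \det (principal_submx C (partial_mx (\row_k v k))).
Proof.
rewrite /clique_det -det_map_mx map_principal_submx map_partial_mx ?rmorph0 //.
by congr (\det (principal_submx C (partial_mx _))); apply/rowP => k; rewrite !mxE /= mevalXU.
Qed.

Lemma clique_det_row (K : fieldType) C (t : 'rV[K]_(nb_edges e)) :
  (clique_det K C).@[t 0] = \det (principal_submx C (partial_mx t)).
Proof.
rewrite clique_detE; congr (\det (principal_submx C (partial_mx _))).
by apply/rowP => k; rewrite mxE.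
Qed.

End PartialMatrices.

(** * Principal minors and semidefinite forms *)

Section PrincipalMinor.
Variables (K : fieldType) (m : nat).
Implicit Types (C : {set 'I_m}) (A : 'M[K]_m) (x : 'rV[K]_m).

Lemma principal_det0P C A :
  reflect (exists x, [/\ x != 0, supported C x & forall j, j \in C -> (x *m A) 0 j = 0])
    (\det (principal_submx C A) == 0).
Proof.
apply: (iffP det0P) => [[y y0 yA]|[x [x0 sx xA]]].
  pose x : 'rV_m := \row_i \sum_(k | enum_val k == i) y 0 k.
  have xE k : x 0 (enum_val k) = y 0 k.
    by rewrite mxE (big_pred1 k) // => l /=; rewrite (inj_eq enum_val_inj).
  have sx : supported C x.
    move=> i iC; rewrite mxE big1 // => k /eqP ki.
    by rewrite -ki enum_valP in iC.
  exists x; split=> //.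
    apply: contra y0 => /eqP x0; apply/eqP/rowP => k.
    by rewrite -xE x0 !mxE.
  move=> j jC; move/rowP/(_ (enum_rank_in jC j)): yA.
  rewrite [X in _ = X -> _]mxE => yAj; rewrite -[RHS]yAj.
  rewrite [LHS]mxE [RHS]mxE (bigID (mem C)) /= [X in _ + X]big1 ?addr0; last first.
    by move=> i /sx ->; rewrite mul0r.
  rewrite [LHS]big_enum_val; apply: eq_bigr => k _.
  by rewrite xE mxE enum_rankK_in.
exists (\row_k x 0 (enum_val k)).
  apply: contra x0 => /eqP y0; apply/eqP/rowP => i; rewrite mxE.
  have [iC|/sx//] := boolP (i \in C).
  by have /rowP/(_ (enum_rank_in iC i)) := y0; rewrite !mxE enum_rankK_in.
apply/rowP => k; rewrite [RHS]mxE -[RHS](xA (enum_val k) (enum_valP k)).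
rewrite [LHS]mxE [RHS]mxE.
rewrite [RHS](bigID (mem C)) /= [X in _ = _ + X]big1 ?addr0; last first.
  by move=> i /sx ->; rewrite mul0r.
rewrite [RHS]big_enum_val; apply: eq_bigr => l _.
by rewrite !mxE.
Qed.

End PrincipalMinor.

Definition psd_on (R : numDomainType) m (S : {set 'I_m}) (A : 'M[R]_m) :=
  forall x, supported S x -> 0 <= bform A x x.

Section PsdMinor.
Variables (R : realFieldType) (m : nat).
Implicit Types (C : {set 'I_m}) (A : 'M[R]_m) (x : 'rV[R]_m).

Lemma posdef_on_det C A : posdef_on C A -> \det (principal_submx C A) != 0.
Proof.
move=> pA; apply/principal_det0P => -[x [x0 sx xA]].
have := pA x sx x0; rewrite /bform mxE big1 ?ltxx // => j _; rewrite [x^T _ _]mxE.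
have [jC|/sx->] := boolP (j \in C); last by rewrite mulr0.
by rewrite xA // mul0r.
Qed.

(** An isotropic vector of a semidefinite form lies in its kernel, so definiteness can fail only if
    the determinant vanishes. *)
Lemma psd_on_det C A :
  A^T = A -> psd_on C A -> \det (principal_submx C A) != 0 -> posdef_on C A.
Proof.
move=> sA pA dA x sx x0; rewrite lt_neqAle pA // andbT eq_sym.
apply: contra dA => /eqP xx; apply/principal_det0P; exists x; split=> // j jC.
have -> : (x *m A) 0 j = bform A x (delta_mx 0 j).
  by rewrite /bform trmx_delta -colE [RHS]mxE.
set y := delta_mx 0 j; apply/eqP/negPn/negP => xy.
(* With this [t] the form takes the value -1 at [y - t *: x]. *)
pose t := (bform A y y + 1) / (bform A x y *+ 2).
have := pA (y - t *: x); rewrite bformBl !bformBr.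
have bZl (u v : 'rV[R]_m) : bform A (t *: u) v = t * bform A u v.
  by rewrite /bform -!scalemxAl mxE.
have bZr (u v : 'rV[R]_m) : bform A u (t *: v) = t * bform A u v.
  by rewrite /bform linearZ /= -!scalemxAr mxE.
rewrite bZl !bZr bZl xx !mulr0 subr0 [bform A y x]bformC // => H.
have {}H : 0 <= bform A y y - t * bform A x y *+ 2.
  rewrite mulr2n opprD addrA; apply: H => i iC; rewrite !mxE sx // mulr0 subr0.
  by rewrite eqxx /=; case: eqP => // ij; rewrite ij jC in iC.
move: H; rewrite -mulrnAr /t divfK ?mulrn_eq0 // opprD addNKr oppr_ge0.
by rewrite leNgt ltr01.
Qed.

End PsdMinor.

(** * The cone and its boundary *)

(** The factor [m] comes from summing |x_i x_j| <= (x_i^2 + x_j^2)/2 over all i and j. *)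
Lemma bform_small (R : realFieldType) m (E : 'M[R]_m) (eta : R) (x : 'rV[R]_m) :
  (forall i j, `|E i j| <= eta) ->
  `|bform E x x| <= eta * (m%:R * \sum_i x 0 i ^+ 2).
Proof.
move=> Ee; rewrite bformE.
apply: le_trans (ler_norm_sum _ _ _) _.
have {Ee} H i j : `|x 0 i * E i j * x 0 j| <= eta * ((x 0 i ^+ 2 + x 0 j ^+ 2) / 2%:R).
  rewrite !normrM mulrAC [X in X <= _]mulrC; apply: ler_pM => //; first exact: mulr_ge0.
  rewrite -(real_normK (num_real (x 0 i))) -(real_normK (num_real (x 0 j))).
  rewrite ler_pdivlMr ?ltr0n // -subr_ge0.
  have := sqr_ge0 (`|x 0 i| - `|x 0 j|); rewrite sqrrB.
  by rewrite mulr_natr addrAC.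
apply: le_trans (ler_sum _ (G := fun i => eta * \sum_j ((x 0 i ^+ 2 + x 0 j ^+ 2) / 2%:R)) _) _.
  move=> i _; rewrite mulr_sumr; apply: le_trans (ler_norm_sum _ _ _) _.
  by apply: ler_sum => j _; exact: H.
rewrite -mulr_sumr (_ : \sum_i _ = m%:R * \sum_i x 0 i ^+ 2) //.
under eq_bigr do rewrite -mulr_suml big_split /= sumr_const card_ord.
rewrite -mulr_suml big_split /= sumr_const card_ord -sumrMnl.
by rewrite -mulr2n -[_ *+ 2]mulr_natr mulfK ?pnatr_eq0 // mulr_natl sumrMnl.
Qed.

Lemma bform_scalem (R : comPzRingType) m (a : R) (A : 'M[R]_m) x :
  bform (a *: A) x x = a * bform A x x.
Proof. by rewrite /bform -scalemxAr -scalemxAl mxE. Qed.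

Section Cone.
Variables (R : realType) (m : nat) (e : rel 'I_m).
Hypotheses (e_refl : reflexive e) (e_sym : ssrbool.symmetric e).
Hypothesis e_chordal : chordal e.
Implicit Types (t : 'rV[R]_(nb_edges e)) (C : {set 'I_m}).

Lemma posdef_on_sub (A : 'M[R]_m) (S S' : {set 'I_m}) :
  S \subset S' -> posdef_on S' A -> posdef_on S A.
Proof.
move=> SS' pA x sx; apply: pA => i iS'; apply: sx.
by apply: contra iS'; apply: (fintype.subsetP SS').
Qed.

Lemma cone_posdef_on t C :
  @completable_cone R m e t -> clique e C -> posdef_on C (partial_mx t).
Proof.
move=> [A [[_ pA] At]] /cliqueP cC x sx x0.
have xC i : x 0 i != 0 -> i \in C by apply: contraR => /sx ->.
rewrite (_ : bform _ x x = bform A x x); first exact: pA.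
by apply: eq_bform => i j /xC iC /xC jC; rewrite At // cC.
Qed.

Lemma posdef_on_cone t :
  (forall C, maximal_clique e C -> posdef_on C (partial_mx t)) ->
  @completable_cone R m e t.
Proof.
move=> pT; have [||A pA At] := chordal_completion e_refl e_sym e_chordal (T := partial_mx t).
- exact: partial_mx_sym.
- move=> C cC; have [C' mC' CC'] := maxset_exists cC.
  exact: posdef_on_sub CC' (pT C' mC').
by exists A.
Qed.

Lemma partial_mxD t u : partial_mx (t + u) = partial_mx t + partial_mx u.
Proof.
apply/matrixP => i j; rewrite !mxE.
by case: (edge_index e i j) => [k|] /=; rewrite ?mxE ?addr0.
Qed.

Lemma partial_mx_le t eta i j :
  0 <= eta -> (forall k, `|t 0 k| <= eta) -> `|partial_mx t i j| <= eta.
Proof.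
by move=> e0 te; rewrite mxE; case: (edge_index e i j) => [k|] //=; rewrite normr0.
Qed.

Lemma closure_cone_psd t C :
  closure (@completable_cone R m e) t -> clique e C -> psd_on C (partial_mx t).
Proof.
move=> clt cC x sx; rewrite leNgt; apply/negP => f0.
set f := bform _ _ _ in f0; pose q := m%:R * \sum_i x 0 i ^+ 2.
have q0 : 0 <= q by rewrite mulr_ge0 ?sumsq_ge0.
have q1 : 0 < q + 1 by rewrite ltr_wpDl.
(* Chosen so that [f + eta * q] equals [- eta]: a point of the cone within [eta] of [t] would still
   have a negative form at [x]. *)
pose eta := - f / (q + 1).
have eta0 : 0 < eta by rewrite divr_gt0 // oppr_gt0.
have [t' [ct' bt']] := clt _ (nbhsx_ballx t _ eta0).
have psd' : 0 <= bform (partial_mx t') x x.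
  have [->|x0] := eqVneq x 0; first by rewrite /bform !mul0mx mxE.
  by apply/ltW/(cone_posdef_on ct' cC).
have small : `|bform (partial_mx (t' - t)) x x| <= eta * q.
  apply: bform_small => i j; apply: partial_mx_le; first exact: ltW.
  move=> k; rewrite !mxE distrC; apply: ltW; exact: ((proj2 bt') 0 k).
move: psd'; rewrite -[t'](subrK t) addrC partial_mxD bformDm -/f => H.
have : 0 <= f + eta * q.
  by apply: le_trans H _; rewrite lerD2l; apply: le_trans (ler_norm _) small.
have -> : f = - (eta * (q + 1)) by rewrite /eta divfK ?opprK // lt0r_neq0.
by rewrite mulrDr mulr1 opprD addrAC addNr add0r oppr_ge0 leNgt eta0.
Qed.

Lemma psd_closure_cone t :
  (forall C, maximal_clique e C -> psd_on C (partial_mx t)) ->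
  closure (@completable_cone R m e) t.
Proof.
move=> pT B /nbhs_ballP[eps /= eps0 tB].
(* Adding a small multiple of the identity makes every semidefinite clique form definite. *)
pose u := edge_row e (1%:M : 'M[R]_m).
exists (t + (eps / 2%:R) *: u); split; last first.
  apply: tB; split=> // i k; rewrite ord1 -ball_normE /= !mxE opprD addNKr normrN.
  apply: le_lt_trans (_ : eps / 2%:R < eps); last first.
    by rewrite ltr_pdivrMr ?ltr0n // ltr_pMr // ltr1n.
  rewrite normrM ger0_norm ?divr_ge0 ?ler0n ?(ltW eps0) //.
  rewrite ler_piMr ?divr_ge0 ?ler0n ?(ltW eps0) //.
  by case: (_ == _); rewrite ?normr1 ?normr0.
apply: posdef_on_cone => C mC x sx x0.
have /cliqueP cC : clique e C by case/maxsetP: mC.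
have xC i : x 0 i != 0 -> i \in C by apply: contraR => /sx ->.
rewrite partial_mxD bformDm; apply: ltr_wpDl; first exact: (pT C mC x sx).
rewrite (_ : bform _ x x = eps / 2%:R * bform 1%:M x x).
  by rewrite bform1 mulr_gt0 ?sumsq_gt0 // divr_gt0 ?ltr0n.
rewrite -bform_scalem; apply: eq_bform => i j /xC iC /xC jC.
have -> : (eps / 2%:R) *: u = edge_row e ((eps / 2%:R) *: 1%:M : 'M[R]_m).
  by apply/rowP => k; rewrite !mxE.
rewrite partial_edge_row ?cC //.
by rewrite linearZ /= trmx1.
Qed.

Lemma cone_boundary_det t :
  @cone_boundary R m e t ->
  exists2 C, maximal_clique e C & \det (principal_submx C (partial_mx t)) = 0.
Proof.
move=> [clt nt]; apply: contrapT => H; apply: nt; apply: posdef_on_cone => C mC.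
apply: psd_on_det; first exact: partial_mx_sym.
  by apply: (closure_cone_psd clt); case/maxsetP: mC.
by apply/eqP => d0; apply: H; exists C.
Qed.

Lemma det_cone_boundary t C :
  (forall C', maximal_clique e C' -> psd_on C' (partial_mx t)) ->
  clique e C -> \det (principal_submx C (partial_mx t)) = 0 ->
  @cone_boundary R m e t.
Proof.
move=> pT cC d0; split; first exact: psd_closure_cone.
by move=> /cone_posdef_on/(_ cC)/posdef_on_det; rewrite d0 eqxx.
Qed.

End Cone.

(** * Parametrization of the singular hypersurfaces *)

Section Parametrization.
Variables (m : nat) (e : rel 'I_m).
Hypotheses (e_refl : reflexive e) (e_sym : ssrbool.symmetric e).
Variables (C : {set 'I_m}) (i0 : 'I_m).
Hypotheses (cC : clique e C) (i0C : i0 \in C).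

(* N X' N^T on C x C, with X' obtained from X by clearing row and column i0,
   and X at the other positions. *)
Definition pencil (A : comPzRingType) (N X : 'M[A]_m) : 'M[A]_m :=
  mask A C *m (N *m (mask A (C :\ i0) *m X *m mask A (C :\ i0)) *m N^T) *m mask A C
  + (X - mask A C *m X *m mask A C).

Lemma map_mask (A B : comPzRingType) (f : {rmorphism A -> B}) (S : {set 'I_m}) :
  map_mx f (mask A S) = mask B S.
Proof.
by apply/matrixP => i j; rewrite !mxE rmorphMn /= rmorph_nat.
Qed.

Lemma map_pencil (A B : comPzRingType) (f : {rmorphism A -> B}) (N X : 'M[A]_m) :
  map_mx f (pencil N X) = pencil (map_mx f N) (map_mx f X).
Proof. by rewrite /pencil map_mxD map_mxB !map_mxM !map_mask map_trmx. Qed.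

Lemma pencil_sym (A : comPzRingType) (N X : 'M[A]_m) :
  X^T = X -> (pencil N X)^T = pencil N X.
Proof.
move=> sX; rewrite /pencil linearD linearB /= !trmx_mul !tr_mask trmxK sX.
by rewrite !mulmxA.
Qed.

Lemma pencil_in (A : comPzRingType) (N X : 'M[A]_m) i j : i \in C -> j \in C ->
  pencil N X i j = (N *m (mask A (C :\ i0) *m X *m mask A (C :\ i0)) *m N^T) i j.
Proof.
move=> iC jC; rewrite /pencil [LHS]mxE mask_mxE [X in _ + X]mxE [X in _ + (_ + X)]mxE mask_mxE.
by rewrite iC jC !mul1r !mulr1 subrr addr0.
Qed.

Definition param (A : comPzRingType) (N X : 'M[A]_m) := edge_row e (pencil N X).

Lemma map_param (A B : comPzRingType) (f : {rmorphism A -> B}) (N X : 'M[A]_m) :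
  map_mx f (param N X) = param (map_mx f N) (map_mx f X).
Proof. by rewrite /param map_edge_row map_pencil. Qed.

Lemma partial_param (A : comPzRingType) (N X : 'M[A]_m) i j :
  X^T = X -> e i j -> partial_mx (param N X) i j = pencil N X i j.
Proof. by move=> sX eij; rewrite partial_edge_row // pencil_sym. Qed.

(** Column [i0] of [N *m Z] is zero, so its block on [C] has a left kernel vector, which also
    annihilates the block of the pencil. *)
Lemma param_singular (K : fieldType) (N X : 'M[K]_m) : X^T = X ->
  \det (principal_submx C (partial_mx (param N X))) = 0.
Proof.
move=> sX; set Z := mask K (C :\ i0).
have : \det (principal_submx C (N *m Z)) == 0.
  rewrite -det_tr trmx_mxsub trmx_mul tr_mask -/(principal_submx C _) -/Z.
  apply/principal_det0P; exists (delta_mx 0 i0); split.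
  - by apply/eqP => /rowP/(_ i0)/eqP; rewrite !mxE !eqxx oner_eq0.
  - by move=> i iC; rewrite mxE eqxx /=; case: eqP iC => // ->; rewrite i0C.
  - move=> j jC; rewrite mulmxA [_ *m Z](_ : _ = 0) ?mul0mx ?mxE //.
    apply/rowP => k; rewrite mul_maskE !mxE !inE eqxx /=.
    by case: (k == i0); rewrite /= ?mulr0 ?mul0r.
case/principal_det0P => x [x0 sx xNZ].
have {}xNZ : x *m N *m Z = 0.
  apply/rowP => j; rewrite [RHS]mxE; have [jC|jC] := boolP (j \in C).
    by rewrite -mulmxA xNZ.
  by rewrite mul_maskE !inE (negPf jC) andbF mulr0.
apply/eqP/principal_det0P; exists x; split=> // j jC.
have -> : (x *m partial_mx (param N X)) 0 j =
    (x *m (N *m (Z *m X *m Z) *m N^T)) 0 j.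
  rewrite !mxE; apply: eq_bigr => i _.
  have [iC|/sx ->] := boolP (i \in C); last by rewrite !mul0r.
  by rewrite partial_param ?pencil_in //; apply: (elimT (cliqueP _ _) cC).
by rewrite !mulmxA xNZ !mul0mx mxE.
Qed.

Lemma tperm_conjE (A : comPzRingType) (X : 'M[A]_m) i j a b :
  (tperm_mx i j *m X *m tperm_mx i j) a b = X (tperm i j a) (tperm i j b).
Proof.
rewrite /tperm_mx -{2}(tpermV i j) -col_permE -row_permE.
by rewrite !mxE.
Qed.

(** Let x be a kernel vector with x_i1 = 1 and [M] the block of T on [C], padded by zeros. The
    matrix [P] = 1 - e_i1^T x has zero column [i1] and satisfies P M = M, hence M = P M P^T by
    symmetry. The transposition [S] moves the cleared index from [i1] to [i0]. *)
Lemma param_surj (K : fieldType) (z : 'rV[K]_(nb_edges e)) :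
  \det (principal_submx C (partial_mx z)) = 0 ->
  exists N X, X^T = X /\ param N X = z.
Proof.
set T := partial_mx z => /eqP/principal_det0P[x [x0 sx xT]].
have {x0} [i1 xn0] : exists i, x 0 i != 0.
  by apply/existsP; apply: contraR x0 => /existsPn x0; apply/eqP/rowP => i;
     rewrite mxE; apply/eqP/negPn.
wlog xi1 : x sx xT xn0 / x 0 i1 = 1.
  move=> H; apply: (H ((x 0 i1)^-1 *: x)).
  - by move=> i /sx xi; rewrite mxE xi mulr0.
  - by move=> j jC; rewrite -scalemxAl mxE xT // mulr0.
  - by rewrite mxE mulVf // oner_eq0.
  - by rewrite mxE mulVf.
have i1C : i1 \in C.
  by apply: contraT => /sx /eqP; rewrite xi1 oner_eq0.
have sT : T^T = T by exact: partial_mx_sym.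
pose IC := mask K C; pose M := IC *m T *m IC.
have sM : M^T = M by rewrite !trmx_mul !tr_mask sT mulmxA.
have ICM : IC *m M *m IC = M.
  apply/matrixP => a b; rewrite mask_mxE mask_mxE.
  by case: (a \in C); case: (b \in C); rewrite ?(mul1r, mulr1, mul0r, mulr0).
pose s := tperm i0 i1; pose S : 'M[K]_m := tperm_mx i0 i1.
have sC a : (s a \in C) = (a \in C).
  by rewrite /s; case: tpermP => [->|->|]; rewrite ?i0C ?i1C.
pose P : 'M[K]_m := 1%:M - (delta_mx 0 i1)^T *m x.
have PM : P *m M = M.
  rewrite /P mulmxBl mul1mx -mulmxA [x *m M](_ : _ = 0) ?mulmx0 ?subr0 //.
  apply/rowP => j; rewrite /M !mulmxA (mask_id sx) mul_maskE [RHS]mxE.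
  by have [/xT->|] := boolP (j \in C); rewrite ?mul0r ?mulr0.
have PZ : P *m mask K (C :\ i1) = P *m IC.
  apply/matrixP => a b; rewrite /mask !mul_mx_diag !mxE big_ord1 !mxE !inE.
  have [->|bi] := eqVneq b i1; last by [].
  by rewrite xi1 eqxx /= mulr0 mulr1 subrr mul0r.
clearbody P.
have SS : S *m S = 1%:M by rewrite -perm_mxM tperm2 perm_mx1.
have SZ : S *m mask K (C :\ i0) *m S = mask K (C :\ i1).
  apply/matrixP => a b; rewrite tperm_conjE !mxE (inj_eq perm_inj) !inE.
  rewrite sC (canF_eq (tpermK i0 i1)) tpermL.
  by [].
(* [T - M] vanishes on the block [C] and carries the entries of [T] elsewhere. *)
exists (P *m S), (S *m M *m S + (T - M)); split.
  by rewrite linearD linearB /= 2!trmx_mul sM sT tr_tperm_mx !mulmxA.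
apply: eq_edge_row => i j eij; rewrite -/T.
suff -> : pencil (P *m S) (S *m M *m S + (T - M)) = T by [].
have maskM0 (D : {set 'I_m}) :
    D \subset C -> mask K D *m (T - M) *m mask K D = 0.
  move=> DC; apply/matrixP => a b; rewrite mask_mxE [RHS]mxE.
  rewrite [(T - M) a b]mxE [(- M) a b]mxE /M mask_mxE.
  have [aD|] := boolP (a \in D); last by rewrite !mul0r.
  have [bD|] := boolP (b \in D); last by rewrite mulr0.
  by rewrite !(fintype.subsetP DC) // !mul1r !mulr1 subrr.
have ICS : IC *m (S *m M *m S) *m IC = S *m M *m S.
  apply/matrixP => a b; rewrite mask_mxE tperm_conjE /M mask_mxE !sC.
  by case: (a \in C); case: (b \in C); rewrite ?(mul1r, mulr1, mul0r, mulr0).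
have key : P *m S *m mask K (C :\ i0) *m S = P *m IC.
  by rewrite -PZ -SZ !mulmxA.
rewrite /pencil -/IC; have MY : M + (T - M) = T by rewrite addrC subrK.
have [Y eY] : exists Y, Y = T - M by exists (T - M).
rewrite -eY in maskM0 MY *.
rewrite !mulmxDr !mulmxDl maskM0 ?addr0; last exact: finset.subsetDl.
rewrite ICS maskM0 // addr0 addrAC subrr add0r.
rewrite (_ : P *m S *m _ *m _ = M); first by rewrite ICM.
clearbody M; rewrite trmx_mul tr_tperm_mx -/S.
have -> : P *m S *m (mask K (C :\ i0) *m (S *m M *m S) *m mask K (C :\ i0)) *m (S *m P^T)
    = (P *m S *m mask K (C :\ i0) *m S) *m M *m (P *m S *m mask K (C :\ i0) *m S)^T.
  by rewrite !trmx_mul tr_mask tr_tperm_mx -/S !mulmxA.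
rewrite key.
have -> : P *m IC *m M *m (P *m IC)^T = P *m (IC *m M *m IC) *m P^T.
  by rewrite trmx_mul tr_mask !mulmxA.
by rewrite ICM PM -{1}sM -trmx_mul PM.
Qed.

End Parametrization.

(** * Restriction of the parametrization to lines *)

Lemma map_mx_line (A B : comPzRingType) (f : {rmorphism A -> B}) m
    (N0 N1 : 'M[A]_m) s :
  map_mx f (N0 + s *: N1) = map_mx f N0 + f s *: map_mx f N1.
Proof. by rewrite map_mxD map_mxZ. Qed.

Section Lines.
Variables (m : nat) (e : rel 'I_m) (C : {set 'I_m}) (i0 : 'I_m) (K : fieldType).
Implicit Types (N X : 'M[K]_m).

Definition line_mx N0 N1 : 'M[{poly K}]_m := map_mx polyC N0 + 'X *: map_mx polyC N1.

Lemma line_mx_horner N0 N1 s :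
  map_mx (horner_eval s) (line_mx N0 N1) = N0 + s *: N1.
Proof. by apply/matrixP => i j; rewrite !mxE /horner_eval !hornerE. Qed.

Lemma pencil_line N0 N1 X0 X1 s :
  map_mx (horner_eval s) (pencil C i0 (line_mx N0 N1) (line_mx X0 X1)) =
  pencil C i0 (N0 + s *: N1) (X0 + s *: X1).
Proof. by rewrite map_pencil !line_mx_horner. Qed.

(** This reduces vanishing on the hypersurface to identities between polynomials in one variable. *)
Lemma param_line (p : {mpoly K[nb_edges e]}) N0 N1 X0 X1 :
  exists f : {poly K}, forall s,
    f.[s] = p.@[param e C i0 (N0 + s *: N1) (X0 + s *: X1) 0].
Proof.
pose t := param e C i0 (line_mx N0 N1) (line_mx X0 X1).
exists (mmap polyC (t 0) p) => s.
rewrite -[LHS]/(horner_eval s _) rmorph_mmap mevalE /mmap.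
apply: eq_bigr => k _; rewrite /= /horner_eval hornerC; congr (_ * _).
apply: eq_bigr => i _; congr (_ ^+ _).
by rewrite /param -pencil_line -map_edge_row [RHS]mxE.
Qed.

End Lines.

(** * Primality of the clique determinants *)

Section Primality.
Variables (m : nat) (e : rel 'I_m).
Hypotheses (e_refl : reflexive e) (e_sym : ssrbool.symmetric e).
Variable (K : numClosedFieldType).
Implicit Types (C : {set 'I_m}) (p q : {mpoly K[nb_edges e]}).

Lemma clique_det0 : clique_det e K finset.set0 = 1.
Proof.
rewrite /clique_det; have : #|finset.set0 : {set 'I_m}| = 0%N by rewrite cards0.
by move: (principal_submx _ _) => A c0; move: A; rewrite c0 => A; rewrite det_mx00.
Qed.

(** Irreducibility through the parametrization: if [p] is nonzero at [v] and [q] at [w], join their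
    parameters by a line. Its image stays on the hypersurface, so the restrictions of [p] and [q]
    have product zero in a domain, although neither is zero. *)
Lemma clique_det_vanish_prime C p q : clique e C ->
  (forall v, (clique_det e K C).@[v] = 0 -> (p * q).@[v] = 0) ->
  (forall v, (clique_det e K C).@[v] = 0 -> p.@[v] = 0) \/
  (forall v, (clique_det e K C).@[v] = 0 -> q.@[v] = 0).
Proof.
move=> cC pq; have [->|[i0 i0C]] := set_0Vmem C.
  by left => v; rewrite clique_det0 meval1 => /eqP; rewrite oner_eq0.
apply: contrapT => /not_orP[/existsNP[v /not_implyP[Dv pv]] /existsNP[w /not_implyP[Dw qw]]].
have [N0 [X0 [sX0 ev]]] : exists N X, X^T = X /\ param e C i0 N X = \row_k v k.
  by apply: param_surj => //; rewrite -clique_detE.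
have [N1 [X1 [sX1 ew]]] : exists N X, X^T = X /\ param e C i0 N X = \row_k w k.
  by apply: param_surj => //; rewrite -clique_detE.
have [f fE] := param_line C i0 p N0 (N1 - N0) X0 (X1 - X0).
have [g gE] := param_line C i0 q N0 (N1 - N0) X0 (X1 - X0).
have fg : f * g = 0.
  apply: poly_fun_eq0 => s; rewrite hornerM fE gE -mevalM; apply: pq.
  rewrite clique_det_row; apply: param_singular => //.
  by rewrite linearD linearZ linearB /= sX0 sX1.
have f0 : f.[0] = p.@[v].
  by rewrite fE !scale0r !addr0 ev; apply: meval_eq => k; rewrite mxE.
have g1 : g.[1] = q.@[w].
  by rewrite gE !scale1r ![_ + (_ - _)]addrC !subrK ew; apply: meval_eq => k; rewrite mxE.
move/eqP: fg; rewrite mulf_eq0 => /orP[]/eqP h0.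
  by apply: pv; rewrite -f0 h0 horner0.
by apply: qw; rewrite -g1 h0 horner0.
Qed.

Lemma translate_clique_det C : clique e C ->
  translate (edge_row e (1%:M : 'M[K]_m) 0) (clique_det e K C) =
  char_poly (- principal_submx C (generic_partial_mx K e)).
Proof.
move=> /cliqueP cC; rewrite /clique_det -det_map_mx /char_poly; congr (\det _).
apply/matrixP => a b; rewrite /char_poly_mx !mxE -(inj_eq enum_val_inj).
have eab := cC _ _ (enum_valP a) (enum_valP b).
have : partial_mx (edge_row e (1%:M : 'M[K]_m)) (enum_val a) (enum_val b) =
    (enum_val a == enum_val b)%:R.
  by rewrite partial_edge_row ?trmx1 // mxE.
rewrite !mxE; case: (edge_index _ _ _) => [k|] /=.
  rewrite mxE translateX => ->; rewrite polyCN opprK addrC; congr (_ + _).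
  by case: (_ == _) => /=; rewrite ?mpolyC1 ?scale1r ?mpolyC0 ?scale0r.
case: (_ == _) => /eqP; first by rewrite eq_sym oner_eq0.
by rewrite [translate _ _]rmorph0 oppr0 polyC0 subr0 mulr0n.
Qed.

Lemma clique_det_radical C q : clique e C ->
  (forall v, (clique_det e K C).@[v] = 0 -> q.@[v] = 0) ->
  mdvd (clique_det e K C) q.
Proof.
(* The diagonal entries 0, ..., m - 1 are distinct, so the characteristic polynomial of each clique
   block is separable at this point. *)
move=> cC; pose a0 := edge_row e (diag_mx (\row_(i < m) (i : nat)%:R) : 'M[K]_m) 0.
apply: (@mdvd_radical _ _ (edge_row e (1%:M : 'M[K]_m) 0) a0).
  by rewrite translate_clique_det // char_poly_monic.
rewrite translate_clique_det // map_char_poly map_mxN map_principal_submx.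
rewrite map_partial_mx; last exact: meval0.
set A := - _.
have -> : A = diag_mx (\row_(k < #|C|) - (val (enum_val k))%:R).
  apply/matrixP => a b; rewrite 2!mxE.
  rewrite (_ : map_mx _ _ = edge_row e (diag_mx (\row_(i < m) (i : nat)%:R) : 'M[K]_m)); last first.
    by apply/rowP => k; rewrite !mxE /= mevalXU /a0 !mxE.
  rewrite partial_edge_row ?tr_diag_mx //; last first.
    by apply: (elimT (cliqueP _ _) cC); apply: enum_valP.
  by rewrite !mxE (inj_eq enum_val_inj); case: eqP => [->|_]; rewrite ?mulr1n ?mulr0n ?oppr0.
rewrite char_poly_trig; last first.
  by apply/is_trig_mxP => i j ij; rewrite mxE -val_eqE ltn_eqF.
set B := diag_mx _.
rewrite -(big_map (fun k => B k k) xpredT (fun x => 'X - x%:P)).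
rewrite separable_prod_XsubC map_inj_uniq ?index_enum_uniq // => i j.
rewrite !mxE !eqxx !mulr1n => /oppr_inj/eqP; rewrite eqr_nat => /eqP.
by move/ord_inj/enum_val_inj.
Qed.

Lemma clique_det_prime C p q : clique e C ->
  mdvd (clique_det e K C) (p * q) ->
  mdvd (clique_det e K C) p \/ mdvd (clique_det e K C) q.
Proof.
move=> cC [h eh]; have [|H|H] := @clique_det_vanish_prime C p q cC.
- by move=> v Dv; rewrite eh mevalM Dv mulr0.
- by left; apply: clique_det_radical.
by right; apply: clique_det_radical.
Qed.

End Primality.

(** * Density of the boundary *)

Lemma horner_near0 (R : realFieldType) (f : {poly R}) :
  exists B, 0 <= B /\ forall s, 0 <= s <= 1 -> `|f.[s] - f.[0]| <= s * B.
Proof.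
elim/poly_ind: f => [|p c [B [B0 IH]]].
  by exists 0; split=> // s _; rewrite !horner0 subrr normr0 mulr0.
exists (`|p.[0]| + B); split; first by rewrite addr_ge0.
move=> s s01; rewrite !hornerE addrK normrM mulrC.
have /andP[s0 s1] := s01; rewrite (ger0_norm s0) ler_wpM2l //.
rewrite -[p.[s]](subrK p.[0]) addrC (le_trans (ler_normD _ _)) // lerD2l.
by rewrite (le_trans (IH s s01)) // ler_piMl.
Qed.

Lemma horner_mx_near0 (R : realType) m n (F : 'M[{poly R}]_(m, n)) (eta : R) : 0 < eta ->
  exists k0, forall k, (k0 <= k)%N -> forall i j,
    `|map_mx (horner_eval k.+1%:R^-1) F i j - map_mx (horner_eval 0) F i j| <= eta.
Proof.
move=> eta0; have /choice[B HB] := fun ij : 'I_m * 'I_n => horner_near0 (F ij.1 ij.2).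
pose S := \sum_ij B ij.
have S0 : 0 <= S by apply: sumr_ge0 => ij _; case: (HB ij).
have BS ij : B ij <= S.
  by rewrite /S (bigD1 ij) //= lerDl sumr_ge0 // => ij' _; case: (HB ij').
(* Beyond this index [k.+1] exceeds [S / eta], and [S] bounds all entrywise constants at once. *)
exists (Num.truncn (S / eta)) => k k0k i j; rewrite !mxE /horner_eval.
have k1 : 0 < k.+1%:R^-1 :> R by rewrite invr_gt0 ltr0n.
have [_ /(_ k.+1%:R^-1) H] := HB (i, j).
apply: le_trans (H _) _; first by rewrite ltW //= invf_le1 ?ltr0n // ler1n.
apply: le_trans (ler_wpM2l (ltW k1) (BS (i, j))) _.
rewrite mulrC ler_pdivrMr ?ltr0n // mulrC -ler_pdivrMr //.
apply: ltW; apply: lt_le_trans (truncnS_gt _) _.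
by rewrite ler_nat.
Qed.

Section Base.
Variables (R : realFieldType) (m : nat).
Variables (C : {set 'I_m}) (i0 : 'I_m).
Hypothesis (i0C : i0 \in C).

(* At X = 1 and this N, the pencil restricted to C is the form
   sum_(j in C) (x_j - x_i0)^2, whose kernel on C is the all-ones vector, so
   that it is definite on every proper subset of C. *)
Definition base_mx : 'M[R]_m := 1%:M - (delta_mx 0 i0 : 'rV[R]_m)^T *m const_mx 1.

Lemma bform_pencil (N X : 'M[R]_m) (x : 'rV[R]_m) :
  bform (pencil C i0 N X) x x =
  bform X (x *m mask R C *m N *m mask R (C :\ i0)) (x *m mask R C *m N *m mask R (C :\ i0))
  + (bform X x x - bform X (x *m mask R C) (x *m mask R C)).
Proof.
have bm S Y (y : 'rV_m) : bform (mask R S *m Y *m mask R S) y y =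
    bform Y (y *m mask R S) (y *m mask R S).
  by rewrite -{2}(tr_mask R S) bform_congr.
rewrite /pencil bformDm bm bform_congr bm bformDm; congr (_ + (_ + _)).
by rewrite -bm /bform mulmxN mulNmx mxE.
Qed.

Lemma mul_baseE (y : 'rV[R]_m) j : (y *m base_mx) 0 j = y 0 j - y 0 i0.
Proof.
by rewrite /base_mx mulmxBr mulmx1 mulmxA trmx_delta -colE !mxE big_ord1 !mxE mulr1.
Qed.

(** Since x_l = 0 with l in [C], the form [Q] bounds x_i0^2. Then x_j^2 <= 2 (x_j - x_i0)^2 + 2
    x_i0^2 <= 4 Q on [C], and summing over the indices gives the factor [m]. *)
Lemma base_pencil_coercive (l : 'I_m) (x : 'rV[R]_m) : l \in C -> x 0 l = 0 ->
  \sum_i x 0 i ^+ 2 <= (4 * m)%:R * bform (pencil C i0 base_mx 1%:M) x x.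
Proof.
move=> lC xl; set Q := bform _ x x.
pose a j := if j \in C then (if j == i0 then 0 else (x 0 j - x 0 i0) ^+ 2) else x 0 j ^+ 2.
have a0 j : 0 <= a j by rewrite /a; do 2?case: ifP => _; rewrite ?sqr_ge0.
have QE : Q = \sum_j a j.
  rewrite /Q bform_pencil !bform1 -sumrB -big_split /=; apply: eq_bigr => j _.
  rewrite !mul_maskE mul_baseE !mul_maskE i0C !inE mulr1 /a.
  case: (j \in C); rewrite /= ?andbT ?andbF ?mulr0 ?mulr1 ?subrr ?expr0n /=.
    by rewrite addr0; case: eqP => _; rewrite ?mulr0 ?expr0n ?mulr1.
  by rewrite subr0 add0r.
have aQ j : a j <= Q by rewrite QE (bigD1 j) //= lerDl sumr_ge0.
have x0Q : x 0 i0 ^+ 2 <= Q.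
  have [l0|l0] := eqVneq l i0; first by rewrite -l0 xl expr0n /= QE sumr_ge0.
  by have := aQ l; rewrite /a lC (negPf l0) xl sub0r sqrrN.
have xQ j : x 0 j ^+ 2 <= 4 * Q.
  have [jC|jC] := boolP (j \in C); last first.
    by have := aQ j; rewrite /a (negPf jC); have := sqr_ge0 (x 0 j); lra.
  have [->|j0] := eqVneq j i0; first by have := sqr_ge0 (x 0 i0); lra.
  have := aQ j; rewrite /a jC (negPf j0).
  by have := sqr_ge0 (x 0 j - 2 * x 0 i0); nra.
apply: le_trans (ler_sum _ (fun i _ => xQ i)) _.
by rewrite sumr_const card_ord -[X in X <= _]mulr_natl mulrCA mulrA -natrM.
Qed.

End Base.

Section Density.
Variables (R : realType) (m : nat) (e : rel 'I_m).
Hypotheses (e_refl : reflexive e) (e_sym : ssrbool.symmetric e).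
Hypothesis e_chordal : chordal e.
Variables (C : {set 'I_m}) (i0 : 'I_m).
Hypotheses (mC : maximal_clique e C) (i0C : i0 \in C).

Let cC : clique e C. Proof. by case/maxsetP: mC. Qed.

(** On [C] itself the form is a pullback of that of [X], which is close to the identity. Any other
    maximal clique misses a vertex of [C], where coercivity of the base form absorbs the
    perturbation. *)
Lemma param_boundary (N1 X1 : 'M[R]_m) : X1^T = X1 ->
  exists k0, forall k, (k0 <= k)%N ->
    @cone_boundary R m e
      (param e C i0 (base_mx R i0 + k.+1%:R^-1 *: N1) (1%:M + k.+1%:R^-1 *: X1)).
Proof.
move=> sX1.
have m0 : (0 < m)%N by case: (m) i0 => [[]|].
have mR : 0 < m%:R :> R by rewrite ltr0n.
(* The perturbation is then at most |x|^2 / (4m), which is the lower bound given by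
   [base_pencil_coercive]. *)
pose eta : R := ((4 * m) * m)%:R^-1.
have eta0 : 0 < eta by rewrite invr_gt0 ltr0n !muln_gt0 m0.
have etam : eta * m%:R = (4 * m)%:R^-1.
  by rewrite /eta natrM invfM divfK ?gt_eqF.
have [k1 Hk1] := horner_mx_near0 (line_mx 1%:M X1) eta0.
have [k2 Hk2] := horner_mx_near0 (pencil C i0 (line_mx (base_mx R i0) N1) (line_mx 1%:M X1)) eta0.
exists (maxn k1 k2) => k; rewrite geq_max => /andP[/Hk1 {}Hk1 /Hk2 {}Hk2].
set s := k.+1%:R^-1 in Hk1 Hk2 *; set N := _ + s *: N1; set X := _ + s *: X1.
have sX : X^T = X by rewrite linearD linearZ /= trmx1 sX1.
have {}Hk1 i j : `|(X - 1%:M) i j| <= eta.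
  by have := Hk1 i j; rewrite !line_mx_horner scale0r addr0 -/X !mxE.
have {}Hk2 i j : `|(pencil C i0 N X - pencil C i0 (base_mx R i0) 1%:M) i j| <= eta.
  have := Hk2 i j; rewrite !pencil_line !scale0r !addr0 -/X -/N => H.
  by rewrite mxE [X in _ + X]mxE.
apply: (det_cone_boundary e_refl e_sym e_chordal _ cC); last exact: param_singular.
move=> C' mC' x sx.
have cC' : clique e C' by case/maxsetP: mC'.
have -> : bform (partial_mx (param e C i0 N X)) x x = bform (pencil C i0 N X) x x.
  have xC' i : x 0 i != 0 -> i \in C' by apply: contraR => /sx ->.
  apply: eq_bform => i j /xC' iC /xC' jC.
  by rewrite partial_param //; apply: (elimT (cliqueP _ _) cC').
have [eC|nC] := eqVneq C' C.
  rewrite eC in sx; rewrite bform_pencil (mask_id sx) subrr addr0.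
  set y := _ *m mask _ _; rewrite -(subrK 1%:M X) bformDm bform1.
  have := bform_small y Hk1; rewrite ler_norml => /andP[H _].
  rewrite -lerBlDr sub0r; apply: le_trans H.
  rewrite lerN2 mulrA ler_piMl ?sumsq_ge0 // etam.
  by rewrite invf_le1 ?ler1n ?ltr0n ?muln_gt0 m0.
have [l lC lC'] : exists2 l, l \in C & l \notin C'.
  apply/subsetPn; apply: contra nC => CC'.
  by case/maxsetP: mC => _ /(_ C' cC' CC') ->.
have := base_pencil_coercive i0C lC (sx l lC').
have -> : bform (pencil C i0 N X) x x =
    bform (pencil C i0 N X - pencil C i0 (base_mx R i0) 1%:M) x x +
    bform (pencil C i0 (base_mx R i0) 1%:M) x x by rewrite -bformDm subrK.
have := bform_small x Hk2; rewrite ler_norml => /andP[H _].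
set q := \sum_i _ in H *; set Q := bform (pencil _ _ (base_mx R i0) _) _ _ => qQ.
rewrite -lerBlDr sub0r; apply: le_trans H; rewrite lerN2.
rewrite mulrA etam.
by rewrite mulrC ler_pdivrMr ?ltr0n ?muln_gt0 ?m0 // mulrC.
Qed.

Local Notation iota := (real_complex R).

Lemma complex_mxE (A : 'M[R[i]]_m) :
  A = map_mx iota (map_mx (@complex.Re R) A) +
      'i *: map_mx iota (map_mx (@complex.Im R) A).
Proof. by apply/matrixP => i j; rewrite !mxE; apply: complexE. Qed.

(** Two passages along lines: from real parameters near the base point to all real ones, then from
    real parameters to complex ones by evaluating Re + s Im at s = 'i. *)
Lemma boundary_vanish (p : {mpoly R[i][nb_edges e]}) :
  (forall t, @cone_boundary R m e t -> p.@[(map_mx iota t) 0] = 0) ->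
  forall v, (clique_det e R[i] C).@[v] = 0 -> p.@[v] = 0.
Proof.
move=> p0.
have real0 (N X : 'M[R]_m) : X^T = X ->
    p.@[param e C i0 (map_mx iota N) (map_mx iota X) 0] = 0.
  move=> sX.
  have [f fE] := param_line C i0 p (map_mx iota (base_mx R i0))
    (map_mx iota (N - base_mx R i0)) (map_mx iota 1%:M) (map_mx iota (X - 1%:M)).
  have fE' s : f.[iota s] = p.@[map_mx iota (param e C i0
      (base_mx R i0 + s *: (N - base_mx R i0)) (1%:M + s *: (X - 1%:M))) 0].
    by rewrite fE map_param !map_mx_line.
  have sX1 : (X - 1%:M)^T = X - 1%:M by rewrite linearB /= sX trmx1.
  have [k0 Hk0] := param_boundary (N - base_mx R i0) sX1.
  have f0 : f = 0.
    apply: (@poly_nat_eq0 _ _ k0) => k kk0.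
    have -> : k.+1%:R^-1 = iota k.+1%:R^-1 by rewrite fmorphV rmorph_nat.
    by rewrite fE'; apply: p0; apply: Hk0.
  have eN : base_mx R i0 + 1 *: (N - base_mx R i0) = N by rewrite scale1r addrC subrK.
  have eX : 1%:M + 1 *: (X - 1%:M) = X by rewrite scale1r addrC subrK.
  have := fE' 1; rewrite eN eX map_param => <-.
  by rewrite f0 horner0.
move=> v Dv; have [N [X [sX ev]]] : exists N X, X^T = X /\ param e C i0 N X = \row_k v k.
  by apply: param_surj => //; rewrite -clique_detE.
have [f fE] := param_line C i0 p (map_mx iota (map_mx (@complex.Re R) N))
  (map_mx iota (map_mx (@complex.Im R) N)) (map_mx iota (map_mx (@complex.Re R) X))
  (map_mx iota (map_mx (@complex.Im R) X)).
have f0 : f = 0.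
  apply: (@poly_nat_eq0 _ _ 0) => k _.
  have -> : k.+1%:R^-1 = iota k.+1%:R^-1 by rewrite fmorphV rmorph_nat.
  rewrite fE -!map_mx_line; apply: real0.
  by rewrite linearD linearZ /= !map_trmx sX.
have := fE 'i; rewrite f0 horner0 -!complex_mxE ev => ->.
by apply: meval_eq => k; rewrite mxE.
Qed.

End Density.

(** * The boundary polynomial *)

Lemma unit_mdvd (R : idomainType) n (p q : {mpoly R[n]}) : p \is a GRing.unit -> mdvd p q.
Proof. by move=> up; exists (q / p); rewrite divrK. Qed.

(** * Products of prime elements *)

Section PrimeFactors.
Variables (R : idomainType) (n : nat) (I : eqType) (D : I -> {mpoly R[n]}) (P : pred I).
Hypothesis D0 : forall i, P i -> D i != 0.
Hypothesis Dprime : forall i p q, P i -> mdvd (D i) (p * q) -> mdvd (D i) p \/ mdvd (D i) q.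

(** Units are allowed among the [D i]: for a graph without vertices the only maximal clique is
    empty, with determinant 1. *)
Lemma prime_mdvd_prod i (Q : pred I) (s : seq I) : P i ->
  mdvd (D i) (\prod_(j <- s | Q j) D j) ->
  D i \is a GRing.unit \/ exists j, [/\ j \in s, Q j & mdvd (D i) (D j)].
Proof.
move=> Pi; elim: s => [|j s IHs].
  by rewrite big_nil => -[h h1]; left; apply/unitrPr; exists h; rewrite mulrC.
rewrite big_cons; have IH : mdvd (D i) (\prod_(j <- s | Q j) D j) ->
    D i \is a GRing.unit \/ exists k, [/\ k \in j :: s, Q k & mdvd (D i) (D k)].
  case/IHs=> [|[k [ks Qk Dk]]]; first by left.
  by right; exists k; rewrite inE ks orbT.
case: ifP => // Qj /(Dprime Pi)[Dj|//].
by right; exists j; rewrite inE eqxx.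
Qed.

Lemma prod_mdvd (s : seq I) H : uniq s ->
  (forall i j, P i -> P j -> i != j -> ~ mdvd (D i) (D j)) ->
  (forall i, P i -> mdvd (D i) H) -> mdvd (\prod_(i <- s | P i) D i) H.
Proof.
move=> us nD DH; elim: s us => [|i s IHs]; first by exists H; rewrite big_nil mulr1.
rewrite big_cons => /andP[iS /IHs[h eH]]; case: ifP => Pi; last by exists h.
suff [k ek] : mdvd (D i) h by exists k; rewrite eH ek mulrA.
have := DH i Pi; rewrite eH => /(Dprime Pi)[//|/(prime_mdvd_prod Pi)[/unit_mdvd //|]].
move=> [j [js Pj]] /(nD i j Pi Pj) []; by apply: contraNneq iS => ->.
Qed.

(* No D i divides g unless it is a unit, so the D i can be cancelled one by
   one from g h. *)
Lemma prime_cancel (s : seq I) g h u :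
  (forall i, P i -> mdvd (D i) g -> D i \is a GRing.unit) ->
  g * h = u * \prod_(i <- s | P i) D i -> exists h', g * h' = u.
Proof.
move=> gD; elim: s h => [|i s IHs] h; first by rewrite big_nil mulr1; exists h.
rewrite big_cons; case: ifP => // Pi eq_gh; last exact: IHs eq_gh.
have [h' eh] : mdvd (D i) h.
  case: (Dprime (i := i) (p := g) (q := h) Pi) => [|/(gD i Pi)|//].
    by exists (u * \prod_(i <- s | P i) D i); rewrite eq_gh [D i * _]mulrC mulrA.
  exact: unit_mdvd.
apply: (IHs h'); apply: (mulIf (D0 Pi)).
by rewrite -mulrA -eh eq_gh [D i * _]mulrC mulrA.
Qed.

End PrimeFactors.

Section Main.
Variables (R : realType) (m : nat) (e : rel 'I_m).
Hypotheses (e_refl : reflexive e) (e_sym : ssrbool.symmetric e).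
Hypothesis e_chordal : chordal e.

Local Notation D := (clique_det e R[i]).
Local Notation mc := (maximal_clique e).
Let P := \prod_(C : {set 'I_m} | mc C) D C.

Lemma maximal_cliqueW C : mc C -> clique e C.
Proof. by case/maxsetP. Qed.

Lemma meval_prod_eq0 v : P.@[v] = 0 <-> exists2 C, mc C & (D C).@[v] = 0.
Proof.
rewrite /P rmorph_prod /=; split=> [/eqP/prodf_eq0[C mC /eqP] DC|[C mC DC]].
  by exists C.
by rewrite (bigD1 C) //= DC mul0r.
Qed.

Lemma meval_row0 n (p : {mpoly R[i][n]}) v : p.@[(\row_k v k) 0] = p.@[v].
Proof. by apply: meval_eq => k; rewrite mxE. Qed.

Lemma boundary_closure :
  zariski_closure (map_mx (real_complex R) @` @cone_boundary R m e) = zero_locus P.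
Proof.
apply/seteqP; split=> z; rewrite /zariski_closure /zero_locus /=.
  move=> H; apply: H => _ [t bt <-] /=; apply/meval_prod_eq0.
  have [C mC dC] := cone_boundary_det e_refl e_sym e_chordal bt.
  exists C => //; rewrite clique_det_row -map_partial_mx ?rmorph0 //.
  by rewrite -map_principal_submx det_map_mx dC rmorph0.
move=> /meval_prod_eq0[C mC DC] p bp.
have [C0|[i0 i0C]] := set_0Vmem C.
  by move: DC; rewrite C0 clique_det0 meval1 => /eqP; rewrite oner_eq0.
apply: (boundary_vanish e_refl e_sym e_chordal mC i0C _ DC) => t bt.
by apply: (bp); exists t.
Qed.

Lemma clique_det_diag C (d : 'rV[R[i]]_m) : clique e C ->
  (D C).@[edge_row e (diag_mx d) 0] = \prod_(i in C) d 0 i.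
Proof.
move=> /cliqueP cC; rewrite clique_det_row [RHS]big_enum_val.
rewrite (_ : principal_submx _ _ = diag_mx (\row_k d 0 (enum_val k))).
  by rewrite det_diag; apply: eq_bigr => k _; rewrite mxE.
apply/matrixP => a b; rewrite mxE partial_edge_row ?tr_diag_mx //; last first.
  by apply: cC; apply: enum_valP.
by rewrite !mxE (inj_eq enum_val_inj).
Qed.

Lemma clique_det_neq0 C : mc C -> D C != 0.
Proof.
move=> /maximal_cliqueW cC; apply/eqP => D0.
have := clique_det_diag (const_mx 1) cC; rewrite D0 meval0 big1 => [|k _].
  by move/esym/eqP; rewrite oner_eq0.
by rewrite mxE.
Qed.

Lemma clique_det_ndvd C C' : mc C -> mc C' -> C != C' -> ~ mdvd (D C) (D C').
Proof.
move=> mC mC' nC [h eh].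
have [l lC lC'] : exists2 l, l \in C & l \notin C'.
  apply/subsetPn; apply: contra nC => CC'.
  by case/maxsetP: mC => _ /(_ C' (maximal_cliqueW mC') CC') ->.
(* At this diagonal matrix the determinant of [C] vanishes while that of [C'] equals 1. *)
pose d : 'rV[R[i]]_m := \row_j (j != l)%:R.
have := clique_det_diag d (maximal_cliqueW mC').
rewrite eh mevalM clique_det_diag ?maximal_cliqueW // (bigD1 l) //= mxE eqxx mul0r mulr0.
move/esym/eqP; rewrite big1 ?oner_eq0 // => j jC'.
by rewrite mxE; case: eqP jC' => // ->; rewrite (negPf lC').
Qed.

Lemma mc_prime C p q : mc C -> mdvd (D C) (p * q) -> mdvd (D C) p \/ mdvd (D C) q.
Proof. by move=> /maximal_cliqueW; apply: clique_det_prime. Qed.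

Lemma prod_squarefree : squarefree P.
Proof.
move=> q r eP.
(* If [D C] divides [q], its square divides [P]. Cancelling one factor, [D C] divides the product
   over the other cliques, which only a unit can do. *)
have key C : mc C -> mdvd (D C) (q ^+ 2) -> D C \is a GRing.unit.
  move=> mC; rewrite expr2 => /(mc_prime mC) qD.
  have [h eq] : mdvd (D C) q by case: qD.
  have: mdvd (D C) (\prod_(C' <- index_enum _ | mc C' && (C' != C)) D C').
    exists (r * h ^+ 2); apply: (mulfI (clique_det_neq0 mC)).
    by rewrite -[LHS](bigD1 C mC) -/P eP eq exprMn_comm; [ring|exact: mulrC].
  case/(prime_mdvd_prod mc_prime mC) => // -[C' [_ /andP[mC' nC']]].
  by move/clique_det_ndvd; case; rewrite // eq_sym.
have : q ^+ 2 * r = 1 * P by rewrite mul1r eP mulrC.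
case/(prime_cancel clique_det_neq0 mc_prime key) => h eh.
by apply/unitrPr; exists (q * h); rewrite mulrA -expr2.
Qed.

Lemma boundary_polynomialP (H : {mpoly R[i][nb_edges e]}) :
  boundary_polynomial H <-> exists c : R[i], c != 0 /\ H = c *: P.
Proof.
rewrite /boundary_polynomial boundary_closure; split; last first.
  move=> [c [c0 ->]]; split.
    move=> q r eP; apply: (prod_squarefree (q := q) (r := c^-1 *: r)).
    by rewrite -scalerAl -eP scalerA mulVf // scale1r.
  apply/seteqP; split=> z; rewrite /zero_locus /= mevalZ.
    by move/eqP; rewrite mulf_eq0 (negPf c0) => /eqP.
  by move=> ->; rewrite mulr0.
move=> [sqH HP].
have HPv v : H.@[v] = 0 <-> P.@[v] = 0.
  have : zero_locus H (\row_k v k) <-> zero_locus P (\row_k v k) by rewrite HP.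
  by rewrite /zero_locus /= !meval_row0.
(* Write H = g P. By squarefreeness no nonunit [D C] divides [g], yet [g] divides a power of [P]
   because its zeros are zeros of [P]. Cancelling all the primes makes [g] a unit, that is, a
   nonzero constant. *)
have [g eg] : mdvd P H.
  apply: (prod_mdvd mc_prime (index_enum_uniq _) clique_det_ndvd) => C mC.
  apply: clique_det_radical => //; first exact: maximal_cliqueW.
  move=> v Dv.
  by apply/HPv/meval_prod_eq0; exists C.
have key C : mc C -> mdvd (D C) g -> D C \is a GRing.unit.
  move=> mC [k ek]; apply: (sqH _ (k * \prod_(C' | mc C' && (C' != C)) D C')).
  by rewrite eg ek /P (bigD1 C mC) /=; ring.
have [d [h eh]] : exists d, mdvd g (P ^+ d).
  by apply: hypersurface_nullstellensatz => v gv; apply/HPv; rewrite eg mevalM gv mul0r.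
have {h eh} [h gh] : exists h, g * h = 1.
  rewrite mulrC in eh; elim: d h eh => [|d IHd] h eh; first by exists h; rewrite -eh.
  move: eh; rewrite exprSr => eh.
  by have /esym/(prime_cancel clique_det_neq0 mc_prime key)[h' /esym/IHd] := eh.
have : g \is a GRing.unit by apply/unitrPr; exists h.
case/andP => /eqP gc uc; exists g@_0; split; first by rewrite -unitfE.
by rewrite eg {1}gc mul_mpolyC.
Qed.

End Main.

Theorem proposition4p1 (R : realType) (m : nat) (e : rel 'I_m)
    (e_refl : reflexive e) (e_sym : ssrbool.symmetric e)
    (e_chordal : chordal e) (H : {mpoly R[i][nb_edges e]}) :
  boundary_polynomial H <->
  exists c : R[i], c != 0 /\
    H = c *: \prod_(C : {set 'I_m} | maximal_clique e C)
               \det (principal_submx C (generic_partial_mx R[i] e)).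
Proof. exact: boundary_polynomialP. Qed.
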